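(* Let $L$ be a $\mathrm{gl}$-regular Nijenhuis operator on a manifold $\mathsf M$ of dimension $n$, $\mathrm d f$ a regular conservation law of $L$, $\check P$ the operator constructed from $\mathrm d f$ as in the context, $M_1,\dots,M_n$ a basis of $\mathrm{Sym}\,L$ and $U\in\mathrm{Sym}\,L$. Let $h_\alpha(p,u)=\frac12\sum_{s,q}(g_\alpha)^{sq}(u)p_sp_q+V_\alpha(u)$, $\alpha=1,\dots,n$, be the functions on $T^*\mathsf M$ defined by $$h_1M_1+\dots+h_nM_n=\check P^2+U.$$ Then: 1. The functions $h_1,\dots,h_n$ are functionally independent on $T^*\mathsf M$, and generically $\det\big((g_1)^{sq}\big)\ne0$, in the following sense: at each point of $\mathsf M$, for generic $(a_1,\dots,a_n)\in\mathbb R^n$ (i.e. outside a proper algebraic subset) one has $\det\big(\sum_k a_k(g_k)^{sq}\big)\neq 0$. In particular, after a suitable change of the basis $M_1,\dots,M_n$ by a constant transition matrix, $g_1$ becomes non-degenerate (locally) and one obtains an integrable geodesic flow with potential. 2. $L$ is self-adjoint with respect to all contravariant symmetric forms $g_\alpha$, that is, $L^j_p(g_\alpha)^{pk}=(g_\alpha)^{jp}L^k_p$. 3. Assume that the good root $R(c,u)=\sqrt{c_1M_1(u)+\dots+c_nM_n(u)-U(u)}$ exists, perhaps locally, as a smooth function of $u=(u^1,\dots,u^n)$ and real parameters $c=(c_1,\dots,c_n)$, and $\det R(c,u)\neq0$. Then the differential form $R^*\mathrm d f$ is closed (on $\mathsf M$) for all values of the parameters $c_1,\dots,c_n$, that is,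 there exists (locally) a function $W(u,c)=W(u^1,\dots,u^n;c_1,\dots,c_n)$ such that $$\mathrm d W=\Big(\sqrt{c_1M_1+\dots+c_nM_n-U}\Big)^*\mathrm d f,$$ where the differential is taken only in the coordinates $u^i$ and the $c_i$ are treated as parameters. This function $W(u,c)$ is a solution of the Hamilton–Jacobi equation $$\tfrac12 (g_1)^{qs}\frac{\partial W}{\partial u^q}\frac{\partial W}{\partial u^s}+V_1(u)=c_1,$$ and moreover $\det\Big(\frac{\partial^2W}{\partial u^i\partial c_\alpha}\Big)\ne0$.
   Context: All constructions are local and smooth. An operator field is a $(1,1)$-tensor field; it is Nijenhuis if $L^2[\xi,\eta]+[L\xi,L\eta]-L[L\xi,\eta]-L[\xi,L\eta]=0$ for all vector fields $\xi,\eta$. $L$ is $\mathrm{gl}$-regular if $\mathrm{Id},L,\dots,L^{n-1}$ are linearly independent at each point (equivalently, they span the centraliser of $L$ at each point). $\mathrm{Sym}\,L$ is the algebra of strong symmetries of $L$: operator fields $M$ with $LM=ML$ and $\langle L,M\rangle=0$, where $\langle L,M\rangle(\xi,\eta)=LM[\xi,\eta]+[L\xi,M\eta]-L[\xi,M\eta]-M[L\xi,\eta]$. A basis of $\mathrm{Sym}\,L$ means $n$ symmetries linearly independent at each point. A conservation law of $L$ is a closed form $\mathrm d f$ with $\mathrm d(L^*\mathrm d f)=0$, where $(L^*\alpha)(\xi)=\alpha(L\xi)$; it is regular if $\mathrm d f,L^*\mathrm d f,\dots,(L^* )^{n-1}\mathrm d f$ are linearly independent at each point. The second companion coordinates are local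 coordinates $u^1,\dots,u^n$ with $\mathrm d u^k=(L^* )^{k-1}\mathrm d f$; with $p_1,\dots,p_n$ the corresponding canonical momenta on $T^*\mathsf M$, $$\check P=p_1\mathrm{Id}+p_2L+\dots+p_nL^{n-1}$$ (at each $(p,u)$ an endomorphism of $T_u\mathsf M$). Equivalently, in arbitrary coordinates, $\check P=\sum_ip_iB_i$ where $B_i\in\mathrm{Span}(\mathrm{Id},L,\dots,L^{n-1})$ is determined by $B_i^*\mathrm d f=\mathrm d u^i$. The functions $h_\alpha$ Poisson commute with respect to the canonical Poisson structure. Functions on $T^*\mathsf M$ are functionally independent if their differentials are linearly independent at generic points (on an open dense subset). A square root $R$ of a linear operator $M$ (i.e. $R^2=M$) is a good root if $R=p(M)$ for some polynomial $p(t)$ with constant coefficients (for a given $M$); $\sqrt M$ denotes a good root. *)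

(* Defs.v *)
From HB Require Import structures.
From mathcomp Require Import all_boot all_order all_algebra.
From mathcomp Require Import all_classical all_reals all_analysis.
From mathcomp Require mpoly.

Set Implicit Arguments.
Unset Strict Implicit.
Unset Printing Implicit Defensive.

Import Order.TTheory GRing.Theory Num.Theory.
Import numFieldNormedType.Exports.
Local Open Scope classical_set_scope.
Local Open Scope ring_scope.

(* Everything is written in a chart: the manifold is an open set D of 'cV_n.+1
   (dimension n.+1 >= 1).  Tangent vectors are columns and covectors are rows,
   so an operator field L : 'cV_n.+1 -> 'M_n.+1 acts by xi |-> L x *m xi and
   its adjoint L^* by alpha |-> alpha *m L x.  Points of T^*D and of the space
   of (parameters, coordinates) are pairs in 'rV_n.+1 * 'cV_n.+1, following the
   order of h(p, u) and R(c, u). *)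

(* C^infinity on D: all iterated directional derivatives are (Frechet)
   differentiable at the points of D. *)
Definition smooth_on (R : realType) (V W : normedModType R) (D : set V)
    (F : V -> W) : Prop :=
  forall (vs : seq V) (x : V), D x ->
    differentiable (foldr (fun v G => 'D_v G : V -> W) F vs) x.

Section Operators.
Context {R : realType} {n : nat}.
Notation point := 'cV[R]_n.+1.
Notation operator_field := (point -> 'M[R]_n.+1).
Implicit Types (D : set point) (L M U : operator_field) (f : point -> R).

Definition lie_bracket (xi eta : point -> 'cV[R]_n.+1) : point -> 'cV[R]_n.+1 :=
  fun x => 'D_(xi x) eta x - 'D_(eta x) xi x.

Definition op_app L (xi : point -> 'cV[R]_n.+1) : point -> 'cV[R]_n.+1 :=
  fun x => L x *m xi x.

Definition nijenhuis D L : Prop :=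
  forall xi eta : point -> 'cV[R]_n.+1, smooth_on D xi -> smooth_on D eta ->
  forall x, D x ->
    L x ^+ 2 *m lie_bracket xi eta x + lie_bracket (op_app L xi) (op_app L eta) x
    - L x *m lie_bracket (op_app L xi) eta x
    - L x *m lie_bracket xi (op_app L eta) x = 0.

Definition gl_regular D L : Prop :=
  forall x, D x -> free [seq L x ^+ k | k <- iota 0 n.+1].

Definition strong_symmetry D L M : Prop :=
  [/\ smooth_on D M,
      forall x, D x -> L x *m M x = M x *m L x
    & forall xi eta : point -> 'cV[R]_n.+1, smooth_on D xi -> smooth_on D eta ->
      forall x, D x ->
        L x *m M x *m lie_bracket xi eta x
        + lie_bracket (op_app L xi) (op_app M eta) x
        - L x *m lie_bracket xi (op_app M eta) x
        - M x *m lie_bracket (op_app L xi) eta x = 0].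

Definition sym_basis D L (M : 'I_n.+1 -> operator_field) : Prop :=
  (forall a, strong_symmetry D L (M a)) /\
  (forall x, D x -> free [seq M a x | a <- enum 'I_n.+1]).

Definition dform f (x : point) : 'rV[R]_n.+1 :=
  \row_i 'D_(delta_mx i 0) f x.

Definition closed_form D (theta : point -> 'rV[R]_n.+1) : Prop :=
  forall x, D x -> forall i j : 'I_n.+1,
    'D_(delta_mx i 0) (fun y => theta y 0 j) x =
    'D_(delta_mx j 0) (fun y => theta y 0 i) x.

Definition conservation_law D L f : Prop :=
  smooth_on D (f : point -> R^o) /\ closed_form D (fun x => dform f x *m L x).

Definition regular_law D L f : Prop :=
  forall x, D x -> free [seq dform f x *m L x ^+ k | k <- iota 0 n.+1].

(* The rows are du^1, ..., du^n for the second companion coordinates u, i.e.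
   this is the Jacobian matrix of u with respect to the chart coordinates. *)
Definition companion_coframe L f (x : point) : 'M[R]_n.+1 :=
  \matrix_(k, j) (dform f x *m L x ^+ k) 0 j.

(* The momenta canonically conjugate to u: the coefficients of the covector p
   in the coframe du^1, ..., du^n. *)
Definition companion_momenta L f (p : 'rV[R]_n.+1) (x : point) : 'rV[R]_n.+1 :=
  p *m invmx (companion_coframe L f x).

Definition checkP L f (p : 'rV[R]_n.+1) (x : point) : 'M[R]_n.+1 :=
  \sum_(k < n.+1) companion_momenta L f p x 0 k *: L x ^+ k.

(* Equivalent description of checkP: it lies in Span(Id, L, ..., L^{n-1}) by
   definition, and checkP(p, x)^* df = p; hence checkP = \sum_i p_i B_i with
   B_i^* df = dx^i. *)
Lemma checkP_dform D L f (p : 'rV[R]_n.+1) (x : point) :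
  regular_law D L f -> D x -> dform f x *m checkP L f p x = p.
Proof.
move=> reg Dx; set C := companion_coframe L f x.
have rowC k : row k C = dform f x *m L x ^+ k.
  by apply/rowP => j; rewrite !mxE.
have Cunit : C \in unitmx.
  rewrite -row_free_unit.
  rewrite -kermx_eq0; apply/rowV0P => v /sub_kermxP vC.
  have sz : size [seq dform f x *m L x ^+ k | k <- iota 0 n.+1] = n.+1.
    by rewrite size_map size_iota.
  have frT : free (Tuple (introT eqP sz)) by exact: reg.
  move/freeP: frT => frT; apply/rowP => i; rewrite mxE.
  apply: (frT (v 0)).
  rewrite -[RHS]vC [RHS]mulmx_sum_row.
  apply: eq_bigr => k _; congr (_ *: _).
  by rewrite rowC (nth_map 0%N) ?size_iota// nth_iota.
rewrite /checkP mulmx_sumr; under eq_bigr do rewrite -scalemxAr -rowC.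
by rewrite -mulmx_sum_row /companion_momenta mulmxKV.
Qed.

Definition quad_ham (g : point -> 'M[R]_n.+1) (V : point -> R)
    (z : 'rV[R]_n.+1 * point) : R :=
  2^-1 * (\sum_s \sum_q g z.2 s q * z.1 0 s * z.1 0 q) + V z.2.

(* The smooth functions h_a = quad_ham (g a) (V a), with symmetric g a, are
   those defined by h_1 M_1 + ... + h_n M_n = checkP^2 + U. *)
Definition is_ham_family D L f (M : 'I_n.+1 -> operator_field) U
    (g : 'I_n.+1 -> point -> 'M[R]_n.+1) (V : 'I_n.+1 -> point -> R) : Prop :=
  [/\ forall a, smooth_on D (g a),
      forall a, smooth_on D (V a : point -> R^o),
      forall a x, D x -> (g a x)^T = g a x
    & forall (p : 'rV[R]_n.+1) x, D x ->
        \sum_a quad_ham (g a) (V a) (p, x) *: M a x =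
        checkP L f p x ^+ 2 + U x].

End Operators.

Section PhaseSpace.
Context {R : realType} {n : nat}.
Notation point := 'cV[R]_n.+1.
Notation phase := ('rV[R]_n.+1 * 'cV[R]_n.+1)%type.
Implicit Types (D : set point) (F G : phase -> R).

Definition partial_fst (i : 'I_n.+1) F : phase -> R :=
  'D_((delta_mx 0 i, 0) : phase) (F : phase -> R^o).

Definition partial_snd (i : 'I_n.+1) F : phase -> R :=
  'D_((0, delta_mx i 0) : phase) (F : phase -> R^o).

Definition cotangent D : set phase := [set z | D z.2].

Definition differential F (z : phase) : 'rV[R]_(n.+1 + n.+1) :=
  row_mx (\row_i partial_fst i F z) (\row_i partial_snd i F z).

Definition functionally_independent D (h : 'I_n.+1 -> phase -> R) : Prop :=
  exists O : set phase,
    [/\ open O, O `<=` cotangent D, cotangent D `<=` closure O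
      & forall z, O z -> free [seq differential (h a) z | a <- enum 'I_n.+1]].

Definition poisson F G (z : phase) : R :=
  \sum_i (partial_fst i F z * partial_snd i G z
          - partial_snd i F z * partial_fst i G z).

Definition integrable_system D (h : 'I_n.+1 -> phase -> R) : Prop :=
  functionally_independent D h /\
  (forall a b z, cotangent D z -> poisson (h a) (h b) z = 0).

End PhaseSpace.

Definition algebraic_set (R : realType) (m : nat) (S : set ('I_m -> R)) : Prop :=
  exists Q : set (mpoly.mpoly m R),
    S = [set a | forall q, Q q -> mpoly.meval a q = 0].

Definition proper_algebraic_set (R : realType) (m : nat)
    (S : set ('I_m -> R)) : Prop :=
  algebraic_set S /\ S != setT.

Definition good_root (R : realType) (n : nat) (A B : 'M[R]_n.+1) : Prop :=
  B ^+ 2 = A /\ exists p : {poly R}, B = horner_mx A p.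

Section RootData.
Context {R : realType} {n : nat}.
Notation point := 'cV[R]_n.+1.
Notation phase := ('rV[R]_n.+1 * 'cV[R]_n.+1)%type.

(* A smooth local good root R(c,u) of c_1 M_1 + ... + c_n M_n - U with
   det R(c,u) != 0; "perhaps locally" means that (c,u) ranges over an open
   set Om of R^n x D. *)
Definition smooth_good_root (D : set point) (M : 'I_n.+1 -> point -> 'M[R]_n.+1)
    (U : point -> 'M[R]_n.+1) (Om : set phase) (rt : phase -> 'M[R]_n.+1) : Prop :=
  [/\ open Om, Om `<=` [set z | D z.2], smooth_on Om rt
    & forall z, Om z ->
        good_root (\sum_a z.1 0 a *: M a z.2 - U z.2) (rt z)
        /\ \det (rt z) != 0].

(* W(u,c) is smooth on Om' and d_u W = rt^* df there. *)
Definition generating_function (f : point -> R) (rt : phase -> 'M[R]_n.+1)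
    (Om' : set phase) (W : phase -> R) : Prop :=
  [/\ open Om', smooth_on Om' (W : phase -> R^o)
    & forall z, Om' z ->
        \row_i partial_snd i W z = dform f z.2 *m rt z].

End RootData.

(* Main.v *)
(* Since df is a cyclic covector of L at every point, an operator B commuting
   with L is determined by the covector df B, such operators commute with each
   other, and checkP is the inverse of B |-> df B.  The algebraic claims follow
   by polarizing the defining equation:
   sum_a g_a(p, q) M_a = 2 checkP(p) checkP(q).

   Differentially, only the tensor <L, B> matters.  It obeys a Leibniz rule in
   B, and if it vanishes then df B is closed: d(df L B)(xi, eta) equals
   d(df B)(L xi, eta), so L is self-adjoint for the 2-form d(df B), and a
   2-form with a cyclic self-adjoint operator is zero.
   - A good root B of an element of Sym L is again in Sym L, because <L, B^2>
     is 2 B <L, B>; hence df B is closed, and W is its primitive, obtained by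
     integration along segments.  Differentiating B^2 = sum_a c_a M_a - U in
     c_a gives the mixed second derivatives of W.
   - Fix a point of T^*M.  On the closed section p = sum_k m_k df L^(k-1) through
     it the operator checkP is sum_k m_k L^(k-1), so that the restrictions k_a of
     the h_a satisfy <L, sum_a k_a M_a> = 0.  This gives
     Y(L xi) = L Y(xi) for Y(xi) = sum_a dk_a(xi) M_a, and commutativity of the
     centraliser of L turns this into {h_a, h_b} = 0. *)
Require Import Defs.
From HB Require Import structures.
From mathcomp Require Import all_boot all_order all_algebra.
From mathcomp Require Import all_classical all_reals all_analysis.
From mathcomp Require Import ring lra.
From mathcomp Require mpoly.

Set Implicit Arguments.
Unset Strict Implicit.
Unset Printing Implicit Defensive.

Import Order.TTheory GRing.Theory Num.Theory.
Import numFieldNormedType.Exports.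
Local Open Scope classical_set_scope.
Local Open Scope ring_scope.

(** * Smooth maps *)

(** Everything is therefore expressed at single points, through the covector df and derivatives
    along constant vectors; the companion coordinates enter only through their coframe, and no
    change of coordinates is performed. In place of a normal form there is a dual cyclic vector v,
    with df L^k v equal to 0 for k < n and to 1 for k = n (the dimension being n + 1), which lets
    bilinear expressions in vectors be rewritten in the commutative algebra of operators commuting
    with L. A good root is a polynomial in an operator commuting with L; this supplies the
    commutation with L that an arbitrary square root may lack. The analytic burden comes from W: its
    mixed derivatives in c and u require smoothness in both variables jointly, so the primitive is
    taken with parameters, as an integral whose derivatives of all orders are integrals of the same
    kind. *)

Section Smooth.
Context {R : realType}.

Section General.
Context {V W : normedModType R}.
Implicit Types (D : set V) (F G : V -> W).

(** Finite-order smoothness, on which the inductions run: the rules for products and inverses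
    involve undifferentiated factors, which must be known at the lower order. The direction peeled
    off is the innermost one, hence the [rcons] in [smooth_onP]. *)
Fixpoint smoothn (k : nat) D F : Prop :=
  (forall x, D x -> differentiable F x) /\
  (if k is j.+1 then forall v, smoothn j D ('D_v F : V -> W) else True).

Lemma smoothn_diff k D F x : smoothn k D F -> D x -> differentiable F x.
Proof. by case: k => [|k] [dF _]; exact: dF. Qed.

Lemma smoothnW k D F : smoothn k.+1 D F -> smoothn k D F.
Proof.
elim: k F => [|k IH] F [dF sF]; first by [].
by split=> // v; apply: IH; exact: sF.
Qed.

Lemma smooth_onP D F : smooth_on D F <-> forall k, smoothn k D F.
Proof.
split=> [sF k|sF vs].
  elim: k F sF => [|k IH] F sF; first by split=> // x; exact: (sF [::]).
  split=> [x|v]; first exact: (sF [::]).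
  by apply: IH => vs x Dx; have := sF (rcons vs v) x Dx; rewrite foldr_rcons.
elim/last_ind: vs F sF => [|vs v IH] F sF x Dx; first by have [dF _] := sF 0%N; exact: dF.
by rewrite foldr_rcons; apply: IH => // k; have [_] := sF k.+1; exact.
Qed.

Lemma smooth_diff D F x : smooth_on D F -> D x -> differentiable F x.
Proof. by move=> sF; exact: (sF [::]). Qed.

Lemma smooth_derive D F v : smooth_on D F -> smooth_on D ('D_v F : V -> W).
Proof. by move=> sF vs x Dx; have := sF (rcons vs v) x Dx; rewrite foldr_rcons. Qed.

Lemma open_near_eq D F G x : open D -> D x -> {in D, F =1 G} ->
  {near x, F =1 G}.
Proof.
move=> oD Dx FG; rewrite /prop_near1; near do apply: FG; near=> y.
by rewrite inE; near: y; exact: open_nbhs_nbhs.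
Unshelve. all: by end_near. Qed.

(** The epsilon form also identifies the differential. It serves for passing to a function with the
    same germ and for differentiating an integral, where the candidate differential is known in
    advance. *)
Lemma differentiable_eps F x (df : {linear V -> W}) : continuous df ->
  (forall e : R, 0 < e -> \forall h \near (0 : V),
     `|F (h + x) - F x - df h| <= e * `|h|) ->
  differentiable F x /\ 'd F x = df :> (V -> W).
Proof.
move=> cdf oF.
have H : F \o shift x = cst (F x) + df +o_ 0 id.
  apply/eqaddoP => e e0; move: (oF e e0); apply: filter_app; near=> h.
  by rewrite /= -![(_ + _ : _ -> _) _]/(_ + _) -![(- _ : _ -> _) _]/(- _) /= opprD addrA.
have dE := diff_unique cdf H; split=> //.
by apply/diff_locallyP; rewrite dE.
Unshelve. all: by end_near. Qed.

Lemma differentiable_epsE F x : differentiable F x -> forall e : R, 0 < e ->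
  \forall h \near (0 : V), `|F (h + x) - F x - 'd F x h| <= e * `|h|.
Proof.
move=> /diff_locally/eqaddoP dF e e0; move: (dF e e0); apply: filter_app; near=> h.
by rewrite /= -![(_ + _ : _ -> _) _]/(_ + _) -![(- _ : _ -> _) _]/(- _) /= opprD addrA.
Unshelve. all: by end_near. Qed.

Lemma near_eq_differentiable F G x : {near x, F =1 G} ->
  differentiable F x -> differentiable G x.
Proof.
move=> FG dF; have FGx := nbhs_singleton FG.
suff H e : 0 < e -> \forall h \near (0 : V),
     `|G (h + x) - G x - 'd F x h| <= e * `|h|.
  by have [] := @differentiable_eps G x _ (diff_continuous dF) H.
move=> e0; have := differentiable_epsE dF e0; apply: filter_app.
have {FG} : \forall y \near x, F y = G y by [].
rewrite (near_shift 0) /=; apply: filter_app.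
near=> h; rewrite subr0 => FGh.
by rewrite FGh FGx.
Unshelve. all: by end_near. Qed.

Lemma smoothn_ext k D F G : open D -> {in D, F =1 G} ->
  smoothn k D F -> smoothn k D G.
Proof.
move=> oD; elim: k F G => [|k IH] F G FG [dF sF].
  by split=> // x Dx; apply: near_eq_differentiable (dF x Dx); exact: open_near_eq FG.
split=> [x Dx|v].
  by apply: near_eq_differentiable (dF x Dx); exact: open_near_eq FG.
apply: IH (sF v) => x; rewrite inE => Dx.
by apply: near_eq_derive; exact: open_near_eq FG.
Qed.

Lemma smooth_ext D F G : open D -> {in D, F =1 G} -> smooth_on D F -> smooth_on D G.
Proof.
by move=> oD FG /smooth_onP sF; apply/smooth_onP => k; exact: smoothn_ext FG (sF k).
Qed.

Lemma smooth_cst D (a : W) : smooth_on D (cst a : V -> W).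
Proof.
move=> vs x _; suff [b ->] : exists b, foldr (fun v G => 'D_v G : V -> W) (cst a) vs = cst b.
  exact: differentiable_cst.
elim: vs => [|v vs [b /= ->]]; first by exists a.
by exists 0; apply/funext => y; exact: derive_cst.
Qed.

Lemma smooth_linear D (f : {linear V -> W}) : continuous f -> smooth_on D f.
Proof.
move=> cf vs x Dx; elim/last_ind: vs => [|vs v _]; first exact: linear_differentiable.
rewrite foldr_rcons.
have -> : 'D_v f = cst (f v) :> (V -> W).
  apply/funext => y; rewrite deriveE; last exact: linear_differentiable.
  by rewrite diff_lin.
exact: (@smooth_cst D (f v)).
Qed.

Lemma smoothnD k D F G : open D -> smoothn k D F -> smoothn k D G ->
  smoothn k D (fun x => F x + G x).
Proof.
move=> oD; elim: k F G => [|k IH] F G [dF sF] [dG sG].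
  by split=> // x Dx; apply: differentiableD; [exact: dF|exact: dG].
split=> [x Dx|v]; first by apply: differentiableD; [exact: dF|exact: dG].
apply: smoothn_ext (IH _ _ (sF v) (sG v)) => // x; rewrite inE => Dx.
by rewrite deriveD//; apply: diff_derivable; [exact: dF|exact: dG].
Qed.

Lemma smoothD D F G : open D -> smooth_on D F -> smooth_on D G ->
  smooth_on D (fun x => F x + G x).
Proof.
by move=> oD /smooth_onP sF /smooth_onP sG; apply/smooth_onP => k; exact: smoothnD.
Qed.

Lemma smooth_sum I (r : seq I) (P : pred I) D (F : I -> V -> W) : open D ->
  (forall i, smooth_on D (F i)) -> smooth_on D (fun x => \sum_(i <- r | P i) F i x).
Proof.
move=> oD sF; elim: r => [|i r IH].
  by under eq_fun do rewrite big_nil; exact: smooth_cst.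
under eq_fun do rewrite big_cons.
by case: (P i) => //; apply: smoothD.
Qed.

End General.

Section Composition.
Context {U V W : normedModType R}.

Lemma derive_comp_affine (F : V -> W) (A : U -> V) (A0 : {linear U -> V}) (c : V) x v :
  continuous A0 -> (forall y, A y = A0 y + c) -> differentiable F (A x) ->
  'D_v (F \o A) x = 'D_(A0 v) F (A x).
Proof.
move=> cA AE dF; have AE' : A = A0 \+ cst c by apply/funext.
have dA0 : differentiable A0 x by exact: linear_differentiable.
have dc : differentiable (cst c : U -> V) x by exact: differentiable_cst.
have dA : differentiable A x by rewrite AE'; exact: differentiableD.
rewrite (deriveE v (differentiable_comp dA dF)) (diff_comp dA dF) /= (deriveE _ dF).
congr ('d F _ _).
by rewrite AE' (diffD dA0 dc) diff_lin// diff_cst /= addr0.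
Qed.

(** An affine map only changes the direction of differentiation, v becoming A0 v, so the chain rule
    keeps its form at every order. Projections and slices at fixed parameters are of this type. *)
Lemma smooth_affine_comp (F : V -> W) (A : U -> V) (A0 : {linear U -> V}) (c : V)
  (D : set V) (D' : set U) :
  open D' -> continuous A0 -> (forall y, A y = A0 y + c) -> (forall y, D' y -> D (A y)) ->
  smooth_on D F -> smooth_on D' (F \o A).
Proof.
move=> oD cA AE DD /smooth_onP sF; have AE' : A = A0 \+ cst c by apply/funext.
have dA x : differentiable A x.
  by rewrite AE'; apply: differentiableD => //; exact: linear_differentiable.
apply/smooth_onP => k; elim: k F {sF}(sF k) => [|k IH] F [dF sF].
  by split=> // x Dx; apply: differentiable_comp => //; exact/dF/DD.
split=> [x Dx|v]; first by apply: differentiable_comp => //; exact/dF/DD.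
apply: smoothn_ext (IH _ (sF (A0 v))) => // x; rewrite inE => Dx /=.
by rewrite -(derive_comp_affine _ cA AE)//; exact/dF/DD.
Qed.

End Composition.

Section Scalar.
Context {V : normedModType R}.
Implicit Types (D : set V) (F G : V -> R).

Lemma smoothnM k D F G : open D -> smoothn k D (F : V -> R^o) -> smoothn k D (G : V -> R^o) ->
  smoothn k D ((fun x => F x * G x) : V -> R^o).
Proof.
move=> oD; elim: k F G => [|k IH] F G [dF sF] [dG sG].
  by split=> // x Dx; apply: differentiableM; [exact: dF|exact: dG].
split=> [x Dx|v]; first by apply: differentiableM; [exact: dF|exact: dG].
have wF : smoothn k D (F : V -> R^o) by apply: smoothnW; split.
have wG : smoothn k D (G : V -> R^o) by apply: smoothnW; split.
apply: smoothn_ext (smoothnD oD (IH _ _ wF (sG v)) (IH _ _ wG (sF v))) => // x.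
rewrite inE => Dx.
by rewrite [RHS]deriveM//; apply: diff_derivable; [exact: dF|exact: dG].
Qed.

Lemma smoothM D F G : open D -> smooth_on D (F : V -> R^o) -> smooth_on D (G : V -> R^o) ->
  smooth_on D ((fun x => F x * G x) : V -> R^o).
Proof.
by move=> oD /smooth_onP sF /smooth_onP sG; apply/smooth_onP => k; exact: smoothnM.
Qed.

Lemma smooth_prod I (r : seq I) D (F : I -> V -> R) : open D ->
  (forall i, smooth_on D (F i : V -> R^o)) ->
  smooth_on D ((fun x => \prod_(i <- r) F i x) : V -> R^o).
Proof.
move=> oD sF; elim: r => [|i r IH].
  by under eq_fun do rewrite big_nil; exact: smooth_cst.
by under eq_fun do rewrite big_cons; exact: smoothM.
Qed.

(** Bootstrap: the derivative of 1/F is -F^-2 'D_v F, which is smooth to order k as soon as 1/F is,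
    and this raises the order of 1/F to k + 1. *)
Lemma smoothV D F : open D -> (forall x, D x -> F x != 0) ->
  smooth_on D (F : V -> R^o) -> smooth_on D ((fun x => (F x)^-1) : V -> R^o).
Proof.
move=> oD F0 /smooth_onP sF; apply/smooth_onP; elim=> [|k IH].
  by split=> // x Dx; apply: differentiableV; [exact: (smoothn_diff (sF 0%N))|exact: F0].
split=> [x Dx|v]; first by apply: differentiableV; [exact: (smoothn_diff (sF 0%N))|exact: F0].
have [dF /(_ v) sFv] := sF k.+1.
have s1 := (smooth_onP _ _).1 (@smooth_cst V R^o D (-1)) k.
have s2 := smoothnM oD (smoothnM oD s1 (smoothnM oD IH IH)) sFv.
apply: smoothn_ext s2 => // x; rewrite inE => Dx.
rewrite [RHS]deriveV; [|exact: F0|by apply: diff_derivable; exact: dF].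
by rewrite /= mulN1r expr2 invfM.
Qed.

End Scalar.

Section Matrix.
Context {V : normedModType R}.
Implicit Types (D : set V).

Lemma differentiable_mx (m n : nat) (F : V -> 'M[R]_(m, n)) x :
  (forall i j, differentiable (fun y => F y i j : R^o) x) -> differentiable F x.
Proof.
move=> dF.
rewrite (_ : F = \sum_(i < m) \sum_(j < n) (fun y => F y i j *: delta_mx i j)); last first.
  apply/funext => y; rewrite [LHS]matrix_sum_delta fct_sumE; apply: eq_bigr => i _.
  by rewrite fct_sumE.
apply: differentiable_sum => i; apply: differentiable_sum => j.
exact: differentiableZl.
Qed.

Lemma differentiable_entry (m n : nat) (F : V -> 'M[R]_(m, n)) x i j :
  differentiable F x -> differentiable (fun y => F y i j : R^o) x.
Proof. by move=> dF; exact: (differentiable_comp dF (differentiable_coord (F x) i j)). Qed.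

Lemma derive_entry (m n : nat) (F : V -> 'M[R]_(m, n)) x v i j :
  differentiable F x -> 'D_v F x i j = 'D_v (fun y => F y i j : R^o) x.
Proof. by move=> dF; rewrite derive_mx ?mxE//; exact: diff_derivable. Qed.

Lemma smooth_mxP (m n : nat) D (F : V -> 'M[R]_(m, n)) : open D ->
  smooth_on D F <-> forall i j, smooth_on D (fun y => F y i j : R^o).
Proof.
move=> oD; split=> [/smooth_onP sF i j|sF].
  apply/smooth_onP => k; elim: k F {sF}(sF k) => [|k IH] F [dF sF].
    by split=> // x Dx; apply: differentiable_entry; exact: dF.
  split=> [x Dx|v]; first by apply: differentiable_entry; exact: dF.
  apply: smoothn_ext (IH _ (sF v)) => // x; rewrite inE => Dx.
  by rewrite derive_entry//; exact: dF.
apply/smooth_onP => k.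
have {}sF i j : smoothn k D (fun y => F y i j : R^o) by have /smooth_onP := sF i j.
elim: k F sF => [|k IH] F sF.
  by split=> // x Dx; apply: differentiable_mx => i j; exact: (smoothn_diff (sF i j)).
have dF x : D x -> differentiable F x.
  by move=> Dx; apply: differentiable_mx => i j; exact: (smoothn_diff (sF i j)).
split=> // v; apply: IH => i j; have [_ /(_ v)] := sF i j.
by apply: smoothn_ext => // x; rewrite inE => Dx; rewrite derive_entry//; exact: dF.
Qed.

Lemma smooth_mulmx (m n p : nat) D (F : V -> 'M[R]_(m, n)) (G : V -> 'M[R]_(n, p)) :
  open D -> smooth_on D F -> smooth_on D G -> smooth_on D (fun x => F x *m G x).
Proof.
move=> oD /(smooth_mxP _ oD) sF /(smooth_mxP _ oD) sG; apply/smooth_mxP => // i j.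
under eq_fun do rewrite mxE.
by apply: smooth_sum => // k; exact: smoothM.
Qed.

Lemma smooth_det (n : nat) D (F : V -> 'M[R]_n) :
  open D -> smooth_on D F -> smooth_on D ((fun x => \det (F x)) : V -> R^o).
Proof.
move=> oD /(smooth_mxP _ oD) sF; apply: smooth_sum => // s.
apply: smoothM => //; first exact: smooth_cst.
exact: smooth_prod.
Qed.

Lemma smooth_invmx (n : nat) D (F : V -> 'M[R]_n) : open D ->
  (forall x, D x -> F x \in unitmx) ->
  smooth_on D F -> smooth_on D (fun x => invmx (F x)).
Proof.
move=> oD uF sF; apply/smooth_mxP => // i j.
have sd := smooth_det oD sF.
(* Cramer's rule, valid on D only: [invmx] returns its argument outside the units. *)
apply: (@smooth_ext _ _ _ ((fun x => (\det (F x))^-1 *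
  ((-1) ^+ (j + i) * \det (row' j (col' i (F x))))) : V -> R^o)) => //.
  by move=> x; rewrite inE => Dx; rewrite /invmx uF// !mxE.
apply: smoothM => //.
  by apply: smoothV => // x Dx; rewrite -unitfE -unitmxE uF.
apply: smoothM => //; first exact: smooth_cst.
apply: smooth_det => //; apply/smooth_mxP => // k l.
under eq_fun do rewrite !mxE.
exact: (smooth_mxP _ oD).1.
Qed.

End Matrix.
End Smooth.

(** * Directional derivatives *)

Section Derivatives.
Context {R : realType}.

Lemma derive_linear (V W : normedModType R) (F : V -> W) x a v w :
  differentiable F x -> 'D_(a *: v + w) F x = a *: 'D_v F x + 'D_w F x.
Proof. by move=> dF; rewrite !(deriveE _ dF) linearP. Qed.

Lemma derive_dirsum (V W : normedModType R) (F : V -> W) x I (r : seq I) (a : I -> R)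
    (v : I -> V) : differentiable F x ->
  'D_(\sum_(i <- r) a i *: v i) F x = \sum_(i <- r) a i *: 'D_(v i) F x.
Proof.
move=> dF; rewrite (deriveE _ dF) linear_sum; apply: eq_bigr => i _.
by rewrite linearZ (deriveE _ dF).
Qed.

Lemma differentiable_mulmx (V : normedModType R) (m n p : nat)
    (F : V -> 'M[R]_(m, n)) (G : V -> 'M[R]_(n, p)) x :
  differentiable F x -> differentiable G x -> differentiable (fun y => F y *m G y) x.
Proof.
move=> dF dG; apply: differentiable_mx => i j.
rewrite (_ : (fun y => _) = \sum_k (fun y => F y i k * G y k j)); last first.
  by apply/funext => y; rewrite mxE fct_sumE.
by apply: differentiable_sum => k; apply: differentiableM; exact: differentiable_entry.
Qed.

Lemma derive_mulmx (V : normedModType R) (m n p : nat)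
    (F : V -> 'M[R]_(m, n)) (G : V -> 'M[R]_(n, p)) x v :
  differentiable F x -> differentiable G x ->
  'D_v (fun y => F y *m G y) x = 'D_v F x *m G x + F x *m 'D_v G x.
Proof.
move=> dF dG; apply/matrixP => i j.
rewrite derive_entry; last exact: differentiable_mulmx.
rewrite (_ : (fun y => _) = \sum_k (fun y => F y i k * G y k j)); last first.
  by apply/funext => y; rewrite mxE fct_sumE.
have dFe k : derivable (fun y => F y i k : R^o) x v.
  by apply: diff_derivable; exact: differentiable_entry.
have dGe k : derivable (fun y => G y k j : R^o) x v.
  by apply: diff_derivable; exact: differentiable_entry.
rewrite derive_sum; last by move=> k; exact: derivableM.
rewrite !mxE -big_split; apply: eq_bigr => k _ /=.
rewrite deriveM// (derive_entry _ _ _ dF) (derive_entry _ _ _ dG).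
by rewrite addrC; congr (_ + _); rewrite -[LHS]mulrC.
Qed.

Lemma derive_scalemx (V : normedModType R) (m n : nat)
    (k : V -> R) (F : V -> 'M[R]_(m, n)) x v :
  differentiable (k : V -> R^o) x -> differentiable F x ->
  differentiable (fun y => k y *: F y) x /\
  'D_v (fun y => k y *: F y) x = k x *: 'D_v F x + 'D_v (k : V -> R^o) x *: F x.
Proof.
move=> dk dF.
have E i j : (fun y => (k y *: F y) i j) = (fun y => k y * F y i j).
  by apply/funext => y; rewrite mxE.
have dkF : differentiable (fun y => k y *: F y) x.
  apply: differentiable_mx => i j; rewrite E.
  by apply: differentiableM => //; exact: differentiable_entry.
split=> //; apply/matrixP => i j.
rewrite derive_entry// E deriveM; [|exact: diff_derivable|]; last first.
  by apply: diff_derivable; exact: differentiable_entry.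
rewrite [RHS]mxE [X in _ = X + _]mxE [X in _ = _ + X]mxE (derive_entry _ _ _ dF).
by congr (_ + _); rewrite -[LHS]mulrC.
Qed.

Lemma is_derive_line (V W : normedModType R) (F : V -> W) (v c : V) (s : R) :
  differentiable F (s *: v + c) ->
  is_derive s 1 (fun s => F (s *: v + c)) ('D_v F (s *: v + c)).
Proof.
move=> dF; pose g : R -> V := fun s => s *: v.
have lg : linear g by move=> a p q; rewrite /g scalerDl scalerA.
pose gL : {linear R -> V} := HB.pack g (GRing.isLinear.Build _ _ _ _ _ lg).
have cg : continuous gL by apply: scalel_continuous.
have E := @derive_comp_affine R R V W F (fun s => s *: v + c) gL c s 1 cg
  (fun=> erefl) dF.
apply: DeriveDef; last by rewrite [LHS]E /= /g scale1r.
have dA : differentiable (fun s : R => s *: v + c) s.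
  apply: (@differentiableD R R V gL (cst c)); last exact: differentiable_cst.
  exact: linear_differentiable cg.
exact: diff_derivable (differentiable_comp dA dF).
Qed.

(** The mean value theorem in the direction v turns the second difference into h times a first
    difference of 'D_v F, to which differentiability of 'D_v F at the single point x applies. *)
Lemma second_difference (V : normedModType R) (F : V -> R) (x v w : V) (e : R) :
  {near x, forall y, differentiable (F : V -> R^o) y} ->
  differentiable ('D_v F : V -> R^o) x -> 0 < e ->
  exists2 d : R, 0 < d & forall h, 0 < h -> h < d ->
    `|F (h *: w + (h *: v + x)) - F (h *: v + x) - F (h *: w + x) + F x
      - h ^+ 2 * 'D_w ('D_v F) x| <= e * h ^+ 2.
Proof.
set G : V -> R^o := 'D_v F => nF dG e0.
(* The two error terms are at most e / C times |h w + s v| and |s v|, with 0 <= s <= h, so their sum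
   is controlled by h (2|v| + |w|); the added 1 keeps C positive. *)
pose C := 2 * `|v| + `|w| + 1.
have C0 : 0 < C by rewrite ltr_wpDl// addr_ge0// mulr_ge0.
have eC : 0 < e / C by rewrite divr_gt0.
have := differentiable_epsE dG eC.
have {nF} : \forall h \near (0 : V), differentiable (F : V -> R^o) (h + x).
  have {nF} : \forall y \near x, differentiable (F : V -> R^o) y by [].
  by rewrite (near_shift 0); apply: filterS => h /=; rewrite subr0.
move=> nF nG; have : \forall h \near (0 : V), differentiable (F : V -> R^o) (h + x) /\
    `|G (h + x) - G x - 'd G x h| <= e / C * `|h| by near=> h; split; near: h.
move=> /nbhs_ballP[r /= r0 rP].
exists (r / C); first by rewrite divr_gt0.
move=> h h0 hr; rewrite ltr_pdivlMr// in hr.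
have inb s t : 0 <= s <= h -> 0 <= t <= h -> ball (0 : V) r (t *: w + s *: v).
  move=> /andP[s0 sh] /andP[t0 th].
  rewrite -ball_normE /= sub0r normrN; apply: le_lt_trans hr.
  rewrite (le_trans (ler_normD _ _))// !normrZ !ger0_norm//.
  have : t * `|w| <= h * `|w| by rewrite ler_wpM2r.
  have : s * `|v| <= h * `|v| by rewrite ler_wpM2r.
  have := mulr_ge0 (ltW h0) (normr_ge0 v); rewrite /C; lra.
pose phi (s : R) : R^o := F (s *: v + (h *: w + x)) - F (s *: v + x).
pose dphi (s : R) : R^o := G (s *: v + (h *: w + x)) - G (s *: v + x).
have line (c : V) (s : R) : differentiable (F : V -> R^o) (s *: v + c) ->
    is_derive s 1 (fun s => F (s *: v + c) : R^o) (G (s *: v + c)).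
  exact: is_derive_line.
have sF t s : 0 <= s <= h -> 0 <= t <= h -> differentiable (F : V -> R^o) (s *: v + (t *: w + x)).
  move=> sh th; have [+ _] := rP _ (inb s t sh th).
  by rewrite addrAC addrC.
have hh : 0 <= h <= h by rewrite lexx ltW.
have zh : (0 : R) <= 0 <= h by rewrite lexx ltW.
have dph s : 0 <= s <= h -> is_derive s 1 phi (dphi s).
  move=> sh; apply: is_deriveB; apply: line; first exact: sF.
  by have := sF 0 s sh zh; rewrite scale0r add0r.
have [||s] := @MVT R phi dphi 0 h h0.
- by move=> s; rewrite in_itv /= => /andP[s0 sh]; apply: dph; rewrite !ltW.
- apply: derivable_within_continuous => s; rewrite in_itv /= => sh.
  by have [] := dph s sh.
rewrite in_itv /= => /andP[s0 sh]; have {s0 sh} sI : 0 <= s <= h by rewrite !ltW.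
rewrite /phi !scale0r !add0r subr0 => E.
have -> : F (h *: w + (h *: v + x)) - F (h *: v + x) - F (h *: w + x) + F x
   = dphi s * h by rewrite -E addrCA; ring.
have [_ /= A1] := rP _ (inb s h sI hh).
have [_ /=] := rP _ (inb s 0 sI zh); rewrite scale0r add0r => A2.
rewrite (deriveE w dG).
have A3 : dphi s - h * 'd G x w = (G (h *: w + s *: v + x) - G x - 'd G x (h *: w + s *: v))
   - (G (s *: v + x) - G x - 'd G x (s *: v)).
  have -> : 'd G x (h *: w + s *: v) = h * 'd G x w + 'd G x (s *: v).
    by rewrite linearD linearZ.
  have -> : G (h *: w + s *: v + x) = G (s *: v + (h *: w + x)).
    by rewrite [h *: w + _]addrC -addrA.
  rewrite /dphi; set p := G _; set q := G _; set r1 := G _.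
  by set dv := 'd G x _; set dw := 'd G x _; ring.
have -> : dphi s * h - h ^+ 2 * 'd G x w = h * (dphi s - h * 'd G x w) by ring.
rewrite normrM (gtr0_norm h0) A3 expr2 mulrCA ler_wpM2l ?(ltW h0)//.
apply: (le_trans (ler_normB _ _)); apply: (le_trans (lerD A1 A2)).
rewrite -mulrDr mulrAC ler_pdivrMr// -mulrA ler_pM2l//.
have Hs : `|s *: v| <= h * `|v|.
  by case/andP: sI => s0 sh; rewrite normrZ ger0_norm// ler_wpM2r.
have Hw : `|h *: w| = h * `|w| by rewrite normrZ gtr0_norm.
have := ler_normD (h *: w) (s *: v); rewrite Hw /C; have := normr_ge0 v; have := normr_ge0 w; nra.
Unshelve. all: by end_near. Qed.

(** Schwarz's theorem: the second difference is symmetric in v and w and, divided by h^2, lies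
    within e / 2 of each of the two mixed derivatives. *)
Lemma derive_sym (V : normedModType R) (F : V -> R) (x v w : V) :
  {near x, forall y, differentiable (F : V -> R^o) y} ->
  differentiable ('D_v F : V -> R^o) x -> differentiable ('D_w F : V -> R^o) x ->
  'D_v ('D_w F : V -> R^o) x = 'D_w ('D_v F : V -> R^o) x.
Proof.
move=> nF dv dw; apply/eqP; rewrite -subr_eq0 -normr_le0; apply/ler_addgt0Pr => e e0.
rewrite add0r.
have e20 : 0 < e / 2 by rewrite divr_gt0.
have [d1 d10 H1] := second_difference w nF dv e20.
have [d2 d20 H2] := second_difference v nF dw e20.
pose h := Num.min d1 d2 / 2.
have m0 : 0 < Num.min d1 d2 by rewrite lt_min d10 d20.
have h0 : 0 < h by rewrite divr_gt0.
have hm : h < Num.min d1 d2 by rewrite /h ltr_pdivrMr// ltr_pMr// ltr1n.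
have /andP[hd1 hd2] : (h < d1) && (h < d2) by rewrite -lt_min.
have {H1} := H1 h h0 hd1; have {H2} := H2 h h0 hd2.
rewrite (addrCA (h *: w)).
set X := F _; set Y := F (h *: v + x); set Z := F (h *: w + x).
set p := 'D_v _ x; set q := 'D_w _ x => A B.
rewrite -(ler_pM2l (exprn_gt0 2 h0)) -[leLHS](_ : `|h ^+ 2 * (p - q)| = _); last first.
  by rewrite normrM (gtr0_norm (exprn_gt0 2 h0)).
have -> : h ^+ 2 * (p - q) = (X - Y - Z + F x - h ^+ 2 * q)
  - (X - Z - Y + F x - h ^+ 2 * p) by ring.
by rewrite (le_trans (ler_normB _ _))// (le_trans (lerD B A))// -mulrDl -splitr mulrC lexx.
Qed.

End Derivatives.

(** * Operators with a cyclic covector *)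

Lemma free_enumP (K : fieldType) (E : vectType K) (m : nat) (v : 'I_m -> E) :
  free [seq v a | a <- enum 'I_m] <-> forall k, \sum_a k a *: v a = 0 -> forall a, k a = 0.
Proof.
have sz : size [seq v a | a <- enum 'I_m] = m by rewrite size_map size_enum_ord.
have vE (a : 'I_m) : (Tuple (introT eqP sz))`_a = v a.
  by rewrite /= (nth_map a) ?size_enum_ord// nth_ord_enum.
have sE (k : 'I_m -> K) :
    \sum_(a < m) k a *: (Tuple (introT eqP sz))`_a = \sum_a k a *: v a.
  by apply: eq_bigr => a _; rewrite vE.
split=> [fv|H].
  have /freeP fr : free (Tuple (introT eqP sz)) by [].
  by move=> k k0; apply: fr; rewrite sE.
suff : free (Tuple (introT eqP sz)) by [].
by apply/freeP => k; rewrite sE; exact: H.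
Qed.

Section CyclicCovector.
Context {F : fieldType} {n : nat} (t : 'rV[F]_n.+1) (L : 'M[F]_n.+1).
Implicit Types (A B W : 'M[F]_n.+1) (p q : 'rV[F]_n.+1).

(** Pointwise algebra over any field: [cyc_mx] is the value of [companion_coframe] and [cyc_op] that
    of [checkP], with t in the role of df. *)
Definition cyc_mx : 'M[F]_n.+1 := \matrix_(k, j) (t *m L ^+ k) 0 j.
Definition cyc_op p : 'M[F]_n.+1 := \sum_(k < n.+1) (p *m invmx cyc_mx) 0 k *: L ^+ k.
(** The vector v with t L^k v = 0 for k < n and t L^n v = 1. The matrix with entries t L^(i+j) v
    vanishes for i + j < n and has ones where i + j = n, so v is cyclic for L acting on columns. *)
Definition cyc_col : 'cV[F]_n.+1 := invmx cyc_mx *m delta_mx ord_max 0.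

Hypothesis uC : cyc_mx \in unitmx.

Lemma row_cyc_mx k : row k cyc_mx = t *m L ^+ k.
Proof. by apply/rowP => j; rewrite !mxE. Qed.

Lemma comm_mxX B k : L *m B = B *m L -> L ^+ k *m B = B *m L ^+ k.
Proof. by move=> LB; apply/esym/commrX/esym. Qed.

Lemma comm_mx_poly (b : 'I_n.+1 -> F) :
  L *m (\sum_k b k *: L ^+ k) = (\sum_k b k *: L ^+ k) *m L.
Proof.
rewrite mulmx_sumr mulmx_suml; apply: eq_bigr => k _.
by rewrite -scalemxAl -scalemxAr; congr (_ *: _); exact: commrX.
Qed.

Lemma cyc_op_comm p : L *m cyc_op p = cyc_op p *m L.
Proof. exact: comm_mx_poly. Qed.

Lemma cyc_opK p : t *m cyc_op p = p.
Proof.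
rewrite /cyc_op mulmx_sumr; under eq_bigr do rewrite -scalemxAr -row_cyc_mx.
by rewrite -mulmx_sum_row mulmxKV.
Qed.

Lemma cyc_inj0 B : L *m B = B *m L -> t *m B = 0 -> B = 0.
Proof.
move=> LB tB; suff CB : cyc_mx *m B = 0 by rewrite -[B](mulKmx uC) CB mulmx0.
by apply/row_matrixP => k; rewrite row_mul row_cyc_mx -mulmxA comm_mxX// mulmxA tB mul0mx row0.
Qed.

Lemma cyc_inj A B : L *m A = A *m L -> L *m B = B *m L -> t *m A = t *m B -> A = B.
Proof.
move=> LA LB tAB; apply/subr0_eq/cyc_inj0; first by rewrite mulmxBl mulmxBr LA LB.
by rewrite mulmxBr tAB subrr.
Qed.

Lemma cyc_opE B : L *m B = B *m L -> B = cyc_op (t *m B).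
Proof. by move=> LB; apply: cyc_inj => //; [exact: cyc_op_comm|rewrite cyc_opK]. Qed.

Lemma comm_mx_polyr B (b : 'I_n.+1 -> F) : L *m B = B *m L ->
  (\sum_k b k *: L ^+ k) *m B = B *m (\sum_k b k *: L ^+ k).
Proof.
move=> LB; rewrite mulmx_suml mulmx_sumr; apply: eq_bigr => k _.
by rewrite -scalemxAl -scalemxAr comm_mxX.
Qed.

Lemma cyc_comm A B : L *m A = A *m L -> L *m B = B *m L -> A *m B = B *m A.
Proof. by move=> /cyc_opE -> LB; exact: comm_mx_polyr. Qed.

Lemma mulmx_comm A B : L *m A = A *m L -> L *m B = B *m L -> L *m (A *m B) = A *m B *m L.
Proof. by move=> LA LB; rewrite mulmxA LA -mulmxA LB mulmxA. Qed.

Lemma cyc_colE k : (k <= n)%N -> (t *m L ^+ k *m cyc_col) 0 0 = (k == n)%:R.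
Proof.
move=> kn; have := @row_cyc_mx (Ordinal (n:=n.+1) (m:=k) kn); rewrite /= => <-.
by rewrite -row_mul /cyc_col mulKVmx// !mxE eqxx andbT.
Qed.

(** Elimination from the top coefficient down: t L^(n-k) kills the terms with i < k, since then n -
    k + i < n; those with i > k are already known to vanish, and b_k is what remains. *)
Lemma cyc_col_inj0 (b : 'I_n.+1 -> F) :
  (\sum_k b k *: L ^+ k) *m cyc_col = 0 -> forall k, b k = 0.
Proof.
move=> bv k; have [m] := ubnP (n - k); elim: m k => // m IH k; rewrite ltnS => nk.
have kn : (k <= n)%N by rewrite -ltnS.
have : (t *m L ^+ (n - k) *m ((\sum_k b k *: L ^+ k) *m cyc_col)) 0 0 = 0.
  by rewrite bv mulmx0 mxE.
rewrite mulmx_suml mulmx_sumr summxE (bigD1 k)//= big1 ?addr0 => [|i ik].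
  rewrite -scalemxAl -scalemxAr mxE mulmxA -(mulmxA t) mulmxE -exprD subnK//.
  by rewrite cyc_colE// eqxx mulr1.
rewrite -scalemxAl -scalemxAr mxE mulmxA -(mulmxA t) mulmxE -exprD.
have [ki|ki|/val_inj e] := ltngtP (val k) (val i); last by rewrite e eqxx in ik.
  rewrite IH ?mul0r//; apply: leq_trans nk; rewrite ltn_sub2l//.
  exact: leq_trans ki (ltn_ord i).
have lt : (n - k + i < n)%N by rewrite -[ltnRHS](subnK kn) ltn_add2l.
by rewrite cyc_colE ?(ltnW lt)// (ltn_eqF lt) mulr0.
Qed.

Lemma cyc_col_inj B : L *m B = B *m L -> B *m cyc_col = 0 -> B = 0.
Proof.
move=> LB; rewrite (cyc_opE LB) => /cyc_col_inj0 b0.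
by rewrite /cyc_op big1// => k _; rewrite b0 scale0r.
Qed.

(** By injectivity in equal dimensions the columns L^k v form a basis. Returning a polynomial in L
    keeps its commutation with L at hand. *)
Lemma cyc_col_surj (w : 'cV[F]_n.+1) :
  exists2 b : 'I_n.+1 -> F, w = (\sum_k b k *: L ^+ k) *m cyc_col
    & L *m (\sum_k b k *: L ^+ k) = (\sum_k b k *: L ^+ k) *m L.
Proof.
pose K : 'M[F]_n.+1 := \matrix_(j, i) (L ^+ j *m cyc_col) i 0.
have KE (b : 'rV[F]_n.+1) : b *m K = ((\sum_k b 0 k *: L ^+ k) *m cyc_col)^T.
  apply/rowP => i; rewrite [RHS]mxE mulmx_suml summxE [LHS]mxE; apply: eq_bigr => k _.
  by rewrite -scalemxAl !mxE.
have uK : K \in unitmx.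
  rewrite -row_free_unit -kermx_eq0; apply/rowV0P => b /sub_kermxP.
  rewrite KE => /(congr1 trmx); rewrite trmxK trmx0 => /cyc_col_inj0 b0.
  by apply/rowP => k; rewrite b0 mxE.
exists (fun k => (w^T *m invmx K) 0 k); last exact: comm_mx_poly.
by apply: trmx_inj; rewrite -KE mulmxKV.
Qed.

Lemma selfadj_poly (O : 'M[F]_n.+1) (b : 'I_n.+1 -> F) : L^T *m O = O *m L ->
  (\sum_k b k *: L ^+ k)^T *m O = O *m (\sum_k b k *: L ^+ k).
Proof.
move=> LO; have LkO k : (L ^+ k)^T *m O = O *m L ^+ k.
  elim: k => [|k IH]; first by rewrite expr0 trmx1 mulmx1 mul1mx.
  by rewrite exprS -mulmxE trmx_mul -mulmxA LO mulmxA IH -mulmxA mulmxE -exprS -exprSr.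
rewrite linear_sum mulmx_suml mulmx_sumr; apply: eq_bigr => k _.
by rewrite linearZ -scalemxAl -scalemxAr LkO.
Qed.

(* Both arguments of the form can be moved onto the cyclic vector, where the
   operators L^i L^j = L^j L^i commute. *)
Lemma selfadj_sym (O : 'M[F]_n.+1) : L^T *m O = O *m L -> O^T = O.
Proof.
move=> LO.
have sym (w w' : 'cV[F]_n.+1) : w^T *m O *m w' = w'^T *m O *m w.
  have [b -> Lb] := cyc_col_surj w; have [b' -> Lb'] := cyc_col_surj w'.
  rewrite !trmx_mul -!(mulmxA _ _ O) !selfadj_poly// -!mulmxA; congr (_ *m (_ *m _)).
  by rewrite (mulmxA (\sum_k b k *: _)) (mulmxA (\sum_k b' k *: _)) (cyc_comm Lb Lb').
apply/matrixP => i j; rewrite mxE.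
have := congr1 (fun A : 'M[F]_1 => A 0 0) (sym (delta_mx j 0) (delta_mx i 0)).
by rewrite !trmx_delta -!rowE -!colE !mxE.
Qed.

End CyclicCovector.

(** * Integrals depending on parameters *)

Section UnitIntegral.
Context {R : realType}.
Implicit Types g h : R -> R.

(** Two-sided continuity, also at the endpoints: the integrands below are continuous there as
    functions on the line, and the pointwise rules for sums and products apply directly. *)
Definition cont01 g := forall t : R, 0 <= t <= 1 -> {for t, continuous g}.

Definition int01 g : R := \int[@lebesgue_measure R]_(t in `[0, 1]) g t.

Lemma eq_int01 g h : (forall t, 0 <= t <= 1 -> g t = h t) -> int01 g = int01 h.
Proof. by move=> gh; apply: eq_Rintegral => t; rewrite inE /= in_itv /=; exact: gh. Qed.

Lemma cont01_within g : cont01 g -> {within `[0, 1], continuous g}.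
Proof.
move=> cg; apply: continuous_in_subspaceT => t.
by rewrite inE /= in_itv /=; exact: cg.
Qed.

Lemma cont01_integrable g : cont01 g ->
  (@lebesgue_measure R).-integrable `[0, 1] (EFin \o g).
Proof.
move=> cg; apply: continuous_compact_integrable; first exact: segment_compact.
exact: cont01_within.
Qed.

Lemma int01D g h : cont01 g -> cont01 h -> int01 (fun t => g t + h t) = int01 g + int01 h.
Proof. by move=> cg ch; apply: RintegralD => //; exact: cont01_integrable. Qed.

Lemma int01B g h : cont01 g -> cont01 h -> int01 (fun t => g t - h t) = int01 g - int01 h.
Proof. by move=> cg ch; apply: RintegralB => //; exact: cont01_integrable. Qed.

Lemma int01Z a g : cont01 g -> int01 (fun t => a * g t) = a * int01 g.
Proof. by move=> cg; apply: RintegralZl => //; exact: cont01_integrable. Qed.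

Lemma cont01_sum (I : Type) (r : seq I) (g : I -> R -> R) :
  (forall i, cont01 (g i)) -> cont01 (fun t => \sum_(i <- r) g i t).
Proof.
move=> cg; elim: r => [|i r IH].
  rewrite (_ : (fun t => _) = fun=> 0); last by apply/funext => t; rewrite big_nil.
  by move=> t t01; exact: cst_continuous.
rewrite (_ : (fun t => _) = fun t => g i t + \sum_(j <- r) g j t); last first.
  by apply/funext => t; rewrite big_cons.
by move=> t t01; apply: continuousD; [exact: cg|exact: IH].
Qed.

Lemma int01_sum (I : Type) (r : seq I) (g : I -> R -> R) : (forall i, cont01 (g i)) ->
  int01 (fun t => \sum_(i <- r) g i t) = \sum_(i <- r) int01 (g i).
Proof.
move=> cg; elim: r => [|i r IH].
  rewrite big_nil (@eq_int01 _ (fun=> 0 * 0)).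
    by rewrite (int01Z 0 (g := fun=> 0)) ?mul0r// => t _; exact: cst_continuous.
  by move=> t _; rewrite big_nil mul0r.
rewrite big_cons -IH -int01D//; last exact: cont01_sum.
by apply: eq_int01 => t _; rewrite big_cons.
Qed.

Lemma int01_le g (m : R) : cont01 g -> (forall t, 0 <= t <= 1 -> `|g t| <= m) ->
  `|int01 g| <= m.
Proof.
move=> cg gm; have ig := cont01_integrable cg.
apply: (le_trans (le_normr_Rintegral _ ig)) => //.
have mu01 : fine (@lebesgue_measure R `[0, 1]) = 1.
  by rewrite lebesgue_measure_itv /= lte_fin ltr01 /= subr0.
rewrite -[leRHS]mulr1 -[X in _ * X]mu01 -Rintegral_cst//.
apply: le_Rintegral => //.
- apply: cont01_integrable => t t01; apply: continuous_comp; first exact: cg.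
  exact: norm_continuous.
- by apply: cont01_integrable => t _; exact: cst_continuous.
Qed.

Lemma int01_FTC (G g : R -> R) : cont01 g ->
  (forall t : R, 0 <= t <= 1 -> is_derive t 1 (G : R -> R^o) (g t)) ->
  int01 g = G 1 - G 0.
Proof.
move=> cg dG.
have cG t : 0 <= t <= 1 -> {for t, continuous G}.
  move=> /dG [dGt _]; apply: differentiable_continuous.
  exact/derivable1_diffP.
rewrite /int01 /Rintegral (@continuous_FTC2 _ g G)//.
- exact: cont01_within.
- split.
  + by move=> t; rewrite in_itv /= => /andP[t0 t1]; have [] := dG t _; rewrite ?ltW.
  + by apply: cvg_at_right_filter; apply: cG; rewrite lexx ler01.
  + by apply: cvg_at_left_filter; apply: cG; rewrite lexx ler01.
- move=> t; rewrite in_itv /= => /andP[t0 t1]; rewrite derive1E.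
  by apply: derive_val; apply: dG; rewrite !ltW.
Qed.

End UnitIntegral.

(** * Differentiation under the integral sign along segments *)

Section ParametricIntegral.
Context {R : realType} {E : normedModType R} {I : finType} (e : I -> E) (co : I -> E -> R).
Hypothesis coE : forall h, h = \sum_i co i h *: e i.
Hypothesis co_le : forall i h, `|co i h| <= `|h|.
Context (P Q : {linear E -> E}) (b : E).
Hypothesis P_le : forall h, `|P h| <= `|h|.
Hypothesis Q_le : forall h, `|Q h| <= `|h|.
Implicit Types (G : E -> R) (O D : set E).

(** P will be the projection to the parameters, Q the projection to the coordinates, and b a base
    point without parameter component: the parameters of z stay fixed while the coordinates run from
    those of b to those of z. *)
Definition seg (t : R) (z : E) : E := P z + t *: Q z + (1 - t) *: b.
Definition dseg (t : R) (h : E) : E := P h + t *: Q h.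

(** Differentiating G along the segment in a direction of Q produces a factor t; the weight t^m
    makes the family of such integrals stable under differentiation. *)
Definition pint (m : nat) G (z : E) : R := int01 (fun t => t ^+ m * G (seg t z)).

Lemma segD t z h : seg t (h + z) = dseg t h + seg t z.
Proof. by rewrite /seg /dseg (linearD P) (linearD Q) scalerDr addrACA -!addrA. Qed.

Lemma le_dseg (t : R) h : 0 <= t <= 1 -> `|dseg t h| <= 2 * `|h|.
Proof.
move=> /andP[t0 t1]; rewrite (le_trans (ler_normD _ _))// mulr_natl mulr2n lerD//.
by rewrite normrZ ger0_norm// (le_trans _ (Q_le h))// ler_piMl.
Qed.

Lemma continuous_seg z : continuous (seg^~ z).
Proof.
move=> t; apply: cvgD.
  by apply: cvgD; [exact: cvg_cst|apply: cvgZr_tmp; exact: cvg_id].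
by apply: cvgZr_tmp; apply: cvgB; [exact: cvg_cst|exact: cvg_id].
Qed.

Lemma cont01_seg m O G z : smoothn 0 O (G : E -> R^o) ->
  (forall t : R, 0 <= t <= 1 -> O (seg t z)) -> cont01 (fun t => t ^+ m * G (seg t z)).
Proof.
move=> [dG _] Oz t t01; apply: continuousM; first exact: exprn_continuous.
apply: (@continuous_comp _ _ _ (seg^~ z) G); first exact: continuous_seg.
by apply: (@differentiable_continuous _ _ _ _ (G : E -> R^o)); apply: dG; exact: Oz.
Qed.

Lemma derive_coord G x h : differentiable (G : E -> R^o) x ->
  'D_h (G : E -> R^o) x = \sum_i co i h * 'D_(e i) (G : E -> R^o) x.
Proof. by move=> dG; rewrite [in LHS](coE h) derive_dirsum. Qed.

(** Compactness of [0,1] makes the neighbourhood of 0 independent of t. *)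
Lemma unif_cont_seg O G z (eps : R) : open O -> smoothn 0 O (G : E -> R^o) ->
  (forall t : R, 0 <= t <= 1 -> O (seg t z)) -> 0 < eps ->
  \forall h \near (0 : E), forall t : R, 0 <= t <= 1 ->
    O (h + seg t z) /\ `|G (h + seg t z) - G (seg t z)| <= eps.
Proof.
move=> oO [dG _] Oz eps0.
have e20 : 0 < eps / 2 by rewrite divr_gt0.
have /compact_near_coveringP := @segment_compact R 0 1.
move=> /(_ E (nbhs (0 : E)) (fun h t => O (h + seg t z) /\
  `|G (h + seg t z) - G (seg t z)| <= eps) _) /=.
suff H : forall t : R, `[0, 1]%classic t -> \forall t' \near t & h \near (0 : E),
    O (h + seg t' z) /\ `|G (h + seg t' z) - G (seg t' z)| <= eps.
  move=> /(_ H); apply: filterS => h sh t t01.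
  by apply: sh; rewrite /= in_itv /=.
move=> t /=; rewrite in_itv /= => t01.
have Ot := Oz t t01.
have cG : {for seg t z, continuous G}.
  by apply: (@differentiable_continuous _ _ _ _ (G : E -> R^o)); exact: dG.
have near_y : \forall y \near seg t z, O y /\ `|G (seg t z) - G y| < eps / 2.
  near=> y; split; near: y; first exact: open_nbhs_nbhs.
  by move/cvgrPdist_lt : cG; exact.
have c2 : (fun p : R * E => seg p.1 z) @ (t, 0 : E) --> seg t z.
  by apply: (@continuous_comp _ _ _ (@fst R E) (seg^~ z) (t, 0 : E));
    [exact: cvg_fst|exact: continuous_seg].
have c1 : (fun p : R * E => p.2 + seg p.1 z) @ (t, 0 : E) --> 0 + seg t z.
  by apply: cvgD c2; exact: cvg_snd.
rewrite add0r in c1.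
have n1 : nbhs (t, 0 : E) (fun p => O (p.2 + seg p.1 z) /\
  `|G (seg t z) - G (p.2 + seg p.1 z)| < eps / 2) := c1 _ near_y.
have n2 : nbhs (t, 0 : E) (fun p => O (seg p.1 z) /\
  `|G (seg t z) - G (seg p.1 z)| < eps / 2) := c2 _ near_y.
apply: (@filterS2 _ (nbhs (t, 0 : E)) _ _ _ _ _ n1 n2) => p /= [Op /ltW A] [_ /ltW B].
split=> //; rewrite (splitr eps) (le_trans _ (lerD B A))// (le_trans _ (ler_normB _ _))//.
by rewrite le_eqVlt; apply/orP; left; apply/eqP; congr `|_|; ring.
Unshelve. all: by end_near. Qed.

(* The increment of G is estimated by the mean value theorem along the segment
   from y to y + k, whose derivative is expressed in the basis e. *)
Lemma unif_diff_seg O G z (eps : R) : open O -> smoothn 1 O (G : E -> R^o) ->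
  (forall t : R, 0 <= t <= 1 -> O (seg t z)) -> 0 < eps ->
  \forall k \near (0 : E), forall t : R, 0 <= t <= 1 ->
    `|G (k + seg t z) - G (seg t z) - 'D_k (G : E -> R^o) (seg t z)| <= eps * `|k|.
Proof.
move=> oO [dG sG] Oz eps0.
(* The error eps / c occurs once for each basis direction; the added 1 keeps c positive. *)
pose c : R := #|I|%:R + 1.
have c0 : 0 < c by rewrite ltr_wpDl.
have ec : 0 < eps / c by rewrite divr_gt0.
have : \forall h \near (0 : E), forall i (t : R), 0 <= t <= 1 ->
    O (h + seg t z) /\ `|'D_(e i) (G : E -> R^o) (h + seg t z) -
      'D_(e i) (G : E -> R^o) (seg t z)| <= eps / c.
  by apply: filter_forall => i; exact: (unif_cont_seg oO (sG (e i)) Oz ec).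
have : \forall h \near (0 : E), forall t : R, 0 <= t <= 1 ->
    O (h + seg t z) /\ `|G (h + seg t z) - G (seg t z)| <= 1.
  have sG0 : smoothn 0 O (G : E -> R^o) by split.
  exact: (unif_cont_seg oO sG0 Oz ltr01).
move=> n1 n2.
have : \forall h \near (0 : E), forall t : R, 0 <= t <= 1 ->
    O (h + seg t z) /\ forall i, `|'D_(e i) (G : E -> R^o) (h + seg t z) -
      'D_(e i) (G : E -> R^o) (seg t z)| <= eps / c.
  near=> h => t t01; split.
    by have [] : O (h + seg t z) /\ `|G (h + seg t z) - G (seg t z)| <= 1
      by move: t t01; near: h.
  move=> i; move: t t01; have : forall i (t : R), 0 <= t <= 1 ->
    O (h + seg t z) /\ `|'D_(e i) (G : E -> R^o) (h + seg t z) -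
      'D_(e i) (G : E -> R^o) (seg t z)| <= eps / c by near: h.
  by move=> H t t01; have [] := H i t t01.
move=> /nbhs_ballP[r /= r0 rP]; apply/nbhs_ballP; exists r => // k kr t t01.
set y := seg t z.
have inb (s : R) : 0 <= s <= 1 -> ball (0 : E) r (s *: k).
  move=> /andP[s0 s1]; move: kr; rewrite -!ball_normE /= !sub0r !normrN.
  by apply: le_lt_trans; rewrite normrZ ger0_norm// ler_piMl.
pose psi (s : R) : R^o := G (s *: k + y).
have dpsi (s : R) : 0 <= s <= 1 -> is_derive s 1 psi ('D_k (G : E -> R^o) (s *: k + y)).
  move=> s01; apply: is_derive_line; apply: dG.
  by have [] := rP _ (inb s s01) t t01.
have [||s] := @MVT R psi (fun s : R => 'D_k (G : E -> R^o) (s *: k + y)) 0 1 ltr01.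
- by move=> s; rewrite in_itv /= => /andP[s0 s1]; apply: dpsi; rewrite !ltW.
- apply: derivable_within_continuous => s; rewrite in_itv /= => s01.
  by have [] := dpsi s s01.
rewrite in_itv /= => /andP[s0 s1]; have {s0 s1} s01 : 0 <= s <= 1 by rewrite !ltW.
rewrite /psi scale1r scale0r add0r subr0 mulr1 => ->.
have [Os Ds] := rP _ (inb s s01) t t01.
rewrite (derive_coord _ (dG _ Os)) (derive_coord _ (dG _ (Oz t t01))) -sumrB.
apply: le_trans (ler_norm_sum _ _ _) _.
apply: (@le_trans _ _ (\sum_(i : I) (eps / c * `|k|))).
  apply: ler_sum => i _; rewrite -mulrBr normrM [leRHS]mulrC ler_pM//.
rewrite sumr_const -mulr_natr.
have -> : eps / c * `|k| * #|I|%:R = eps * `|k| * (#|I|%:R / c) by field; rewrite gt_eqF.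
by rewrite ler_piMr ?mulr_ge0 ?(ltW eps0)// ler_pdivrMr// mul1r /c lerDl.
Unshelve. all: by end_near. Qed.

Lemma pintD m O G H z : smoothn 0 O (G : E -> R^o) -> smoothn 0 O (H : E -> R^o) ->
  (forall t : R, 0 <= t <= 1 -> O (seg t z)) ->
  pint m (fun y => G y + H y) z = pint m G z + pint m H z.
Proof.
move=> sG sH Oz; rewrite /pint -int01D; [|exact: cont01_seg Oz|exact: cont01_seg Oz].
by apply: eq_int01 => t _; rewrite mulrDr.
Qed.

Lemma pintZ m O G a z : smoothn 0 O (G : E -> R^o) ->
  (forall t : R, 0 <= t <= 1 -> O (seg t z)) ->
  pint m (fun y => a * G y) z = a * pint m G z.
Proof.
move=> sG Oz; rewrite /pint -int01Z; last exact: cont01_seg Oz.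
by apply: eq_int01 => t _; rewrite mulrCA.
Qed.

Lemma pint_ext m G H z : (forall t : R, 0 <= t <= 1 -> G (seg t z) = H (seg t z)) ->
  pint m G z = pint m H z.
Proof. by move=> GH; apply: eq_int01 => t t01; rewrite GH. Qed.

(** The differential of [seg t] is P + t Q, which suggests the candidate; the first-order estimate,
    being uniform in t, can be integrated. Continuity of the candidate comes from its values on the
    finitely many e i. *)
Lemma pint_diff m O D G z : open O -> open D ->
  (forall y (t : R), D y -> 0 <= t <= 1 -> O (seg t y)) ->
  smoothn 1 O (G : E -> R^o) -> D z ->
  differentiable (pint m G : E -> R^o) z /\
  forall h, 'D_h (pint m G : E -> R^o) z =
    pint m ('D_(P h) (G : E -> R^o)) z + pint m.+1 ('D_(Q h) (G : E -> R^o)) z.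
Proof.
move=> oO oD DO sG Dz; have [dG s0] := sG.
have Oz t := DO z t Dz.
pose df h : R^o := pint m ('D_(P h) (G : E -> R^o)) z + pint m.+1 ('D_(Q h) (G : E -> R^o)) z.
have ldf : linear df.
  move=> a u v; rewrite /df (linearP P) (linearP Q).
  have H j (A : {linear E -> E}) : pint j ('D_(a *: A u + A v) (G : E -> R^o)) z =
      a * pint j ('D_(A u) (G : E -> R^o)) z + pint j ('D_(A v) (G : E -> R^o)) z.
    have sZ : smoothn 0 O ((fun y => a * 'D_(A u) (G : E -> R^o) y) : E -> R^o).
      split=> // x Ox; apply: differentiableM; first exact: differentiable_cst.
      by have [+ _] := s0 (A u); exact.
    rewrite -(pintZ j a (s0 (A u)) Oz) -(pintD j sZ (s0 (A v)) Oz).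
    by apply: pint_ext => t t01; rewrite derive_linear//; exact/dG/Oz.
  by rewrite (H m P) (H m.+1 Q) addrACA -mulrDr.
pose dfL : {linear E -> R^o} := HB.pack df (GRing.isLinear.Build _ _ _ _ _ ldf).
have cdf : continuous dfL.
  apply/bounded_linear_continuous/linear_boundedP.
  exists (\sum_i `|df (e i)|); rewrite num_real; split=> // r Mr h.
  have -> : dfL h = \sum_i co i h * df (e i).
    rewrite [in LHS](coE h) linear_sum; apply: eq_bigr => i _.
    by rewrite linearZ.
  apply: le_trans (ler_norm_sum _ _ _) _.
  apply: (@le_trans _ _ ((\sum_i `|df (e i)|) * `|h|)); last by rewrite ler_wpM2r// ltW.
  rewrite mulr_suml; apply: ler_sum => i _; rewrite normrM mulrC ler_wpM2l//.
suff est eps : 0 < eps -> \forall h \near (0 : E),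
    `|pint m G (h + z) - pint m G z - dfL h| <= eps * `|h|.
  have [dp dpE] := @differentiable_eps R E R^o (pint m G) z dfL cdf est.
  by split=> // h; rewrite deriveE// dpE.
move=> eps0; have e20 : 0 < eps / 2 by rewrite divr_gt0.
have := unif_diff_seg oO sG Oz e20 => /nbhs_ballP[r /= r0 rP].
have : \forall y \near z, D y by exact: open_nbhs_nbhs.
rewrite (near_shift 0) /= => /nbhs_ballP[r' /= r'0 rP'].
(* r' keeps h + z in D, hence its segment in O; r / 2, like eps / 2 above, absorbs the factor 2 in
   the bound |dseg t h| <= 2|h|. *)
apply/nbhs_ballP; exists (Num.min r' (r / 2)).
  by rewrite /= lt_min r'0 divr_gt0.
move=> h; rewrite -ball_normE /= sub0r normrN lt_min => /andP[hr' hr].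
have Dh : D (h + z).
  by have := rP' h; rewrite /= subr0; apply; rewrite -ball_normE /= sub0r normrN.
have Oh t := DO (h + z) t Dh.
have sG0 : smoothn 0 O (G : E -> R^o) by split.
have c1 := cont01_seg (m := m) sG0 Oh; have c2 := cont01_seg (m := m) sG0 Oz.
have c3 := cont01_seg (m := m) (s0 (P h)) Oz; have c4 := cont01_seg (m := m.+1) (s0 (Q h)) Oz.
have c12 : cont01 (fun t => t ^+ m * G (seg t (h + z)) - t ^+ m * G (seg t z)).
  by move=> t t01; apply: continuousB; [exact: c1|exact: c2].
have c34 : cont01 (fun t => t ^+ m * 'D_(P h) (G : E -> R^o) (seg t z) +
    t ^+ m.+1 * 'D_(Q h) (G : E -> R^o) (seg t z)).
  by move=> t t01; apply: continuousD; [exact: c3|exact: c4].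
rewrite /= /df /pint -int01B// -int01D// -int01B//.
apply: int01_le.
  by move=> t t01; apply: continuousB; [exact: c12|exact: c34].
move=> t t01; have /andP[t0 t1] := t01.
have -> : t ^+ m.+1 * 'D_(Q h) (G : E -> R^o) (seg t z) =
    t ^+ m * (t * 'D_(Q h) (G : E -> R^o) (seg t z)) by rewrite exprSr mulrA.
rewrite -mulrBr -mulrDr -mulrBr normrM.
have -> : 'D_(P h) (G : E -> R^o) (seg t z) + t * 'D_(Q h) (G : E -> R^o) (seg t z) =
    'D_(dseg t h) (G : E -> R^o) (seg t z).
  by rewrite /dseg addrC [P h + _]addrC derive_linear//; exact/dG/Oz.
have kh := le_dseg h t01.
apply: (@le_trans _ _ (1 * (eps / 2 * `|dseg t h|))).
  apply: ler_pM => //; first by rewrite ger0_norm ?exprn_ge0// exprn_ile1.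
  rewrite segD; apply: rP => //; rewrite -ball_normE /= sub0r normrN.
  by rewrite (le_lt_trans kh)// mulrC -ltr_pdivlMr.
rewrite mul1r; apply: (le_trans (ler_wpM2l (ltW e20) kh)).
by rewrite mulrA divfK.
Qed.

Lemma smooth_pint m O D G : open O -> open D ->
  (forall y (t : R), D y -> 0 <= t <= 1 -> O (seg t y)) ->
  smooth_on O (G : E -> R^o) -> smooth_on D (pint m G : E -> R^o).
Proof.
move=> oO oD DO sG; apply/smooth_onP => k.
elim: k m G sG => [|k IH] m G sG; have sG1 := (smooth_onP _ _).1 sG 1%N.
  by split=> // z Dz; have [] := pint_diff m oO oD DO sG1 Dz.
split=> [z Dz|v]; first by have [] := pint_diff m oO oD DO sG1 Dz.
apply: smoothn_ext (smoothnD oD (IH m _ (smooth_derive (P v) sG))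
  (IH m.+1 _ (smooth_derive (Q v) sG))) => // z; rewrite inE => Dz.
by have [_ ->] := pint_diff m oO oD DO sG1 Dz.
Qed.

End ParametricIntegral.

(** * Primitives of closed forms depending on parameters *)

Section Primitive.
Context {R : realType} {n : nat}.
Notation phase := ('rV[R]_n.+1 * 'cV[R]_n.+1)%type.
Implicit Types (z h : phase) (al : phase -> 'rV[R]_n.+1) (O : set phase).

Definition phase_basis (i : 'I_n.+1 + 'I_n.+1) : phase :=
  match i with inl j => (delta_mx 0 j, 0) | inr j => (0, delta_mx j 0) end.
Definition phase_coord (i : 'I_n.+1 + 'I_n.+1) (z : phase) : R :=
  match i with inl j => z.1 0 j | inr j => z.2 j 0 end.

Lemma snd_dirE (w : 'cV[R]_n.+1) :
  ((0, w) : phase) = \sum_j w j 0 *: ((0, delta_mx j 0) : phase).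
Proof.
rewrite [in LHS](matrix_sum_delta w).
apply: (big_ind2 (fun (a : 'cV[R]_n.+1) (b : phase) => (0, a) = b)) => //.
  by move=> a b c d <- <-; rewrite -[RHS]/(0 + 0, a + c) addr0.
by move=> i _; rewrite big_ord1 -[RHS]/(w i 0 *: 0, w i 0 *: delta_mx i 0) scaler0.
Qed.

Lemma fst_dirE (w : 'rV[R]_n.+1) :
  ((w, 0) : phase) = \sum_j w 0 j *: ((delta_mx 0 j, 0) : phase).
Proof.
rewrite [in LHS](matrix_sum_delta w) big_ord1.
apply: (big_ind2 (fun (a : 'rV[R]_n.+1) (b : phase) => (a, 0) = b)) => //.
  by move=> a b c d <- <-; rewrite -[RHS]/(a + c, 0 + 0) addr0.
by move=> i _; rewrite -[RHS]/(w 0 i *: delta_mx 0 i, w 0 i *: 0) scaler0.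
Qed.

Lemma phase_coordE h : h = \sum_i phase_coord i h *: phase_basis i.
Proof.
rewrite big_sumType /= -snd_dirE -fst_dirE.
by case: h => a b; rewrite -[RHS]/(a + 0, 0 + b) addr0 add0r.
Qed.

Lemma phase_coord_le i h : `|phase_coord i h| <= `|h|.
Proof.
rewrite prod_normE le_max; case: i => j /=; apply/orP; [left|right];
  rewrite [leRHS]/Num.Def.normr /= mx_normrE.
  exact: (le_bigmax _ (fun ij => `|h.1 ij.1 ij.2|) (0, j)).
exact: (le_bigmax _ (fun ij => `|h.2 ij.1 ij.2|) (j, 0)).
Qed.

Definition phase_fst z : phase := (z.1, 0).
Definition phase_snd z : phase := (0, z.2).

Lemma phase_fst_linear : linear phase_fst.
Proof. by move=> a z h; rewrite /phase_fst -[RHS]/(_, a *: 0 + 0) scaler0 addr0. Qed.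
Lemma phase_snd_linear : linear phase_snd.
Proof. by move=> a z h; rewrite /phase_snd -[RHS]/(a *: 0 + 0, _) scaler0 addr0. Qed.
HB.instance Definition _ := GRing.isLinear.Build _ _ _ _ phase_fst phase_fst_linear.
HB.instance Definition _ := GRing.isLinear.Build _ _ _ _ phase_snd phase_snd_linear.

Lemma phase_fst_le h : `|phase_fst h| <= `|h|.
Proof. by rewrite !prod_normE /= normr0 ge_max le_max lexx le_max normr_ge0. Qed.
Lemma phase_snd_le h : `|phase_snd h| <= `|h|.
Proof. by rewrite !prod_normE /= normr0 ge_max !le_max lexx normr_ge0 orbT. Qed.

Lemma smooth_snd O : smooth_on O (snd : phase -> 'cV[R]_n.+1).
Proof. by apply: (@smooth_linear _ _ _ _ (snd : {linear phase -> _})) => z; exact: cvg_snd. Qed.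

Lemma smooth_fst O : smooth_on O (fst : phase -> 'rV[R]_n.+1).
Proof. by apply: (@smooth_linear _ _ _ _ (fst : {linear phase -> _})) => z; exact: cvg_fst. Qed.

Lemma smooth_entry (V : normedModType R) (D : set V) (k l : nat) (F : V -> 'M[R]_(k, l)) i j :
  open D -> smooth_on D F -> smooth_on D ((fun x => F x i j) : V -> R^o).
Proof. by move=> oD /(smooth_mxP _ oD). Qed.

(** Poincare lemma in u with c as a parameter: W(c,u) = sum_i (u - u0)_i times the integral of
    al_i(c, u0 + t(u - u0)) over [0,1]. After closedness exchanges the indices, dW/du^j is the
    integral of the t-derivative of t al_j(c, u0 + t(u - u0)), that is al_j(c,u). *)
Lemma param_primitive O al z0 : open O -> smooth_on O al -> O z0 ->
  (forall z, O z -> forall i j, partial_snd i (fun y => al y 0 j) z =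
     partial_snd j (fun y => al y 0 i) z) ->
  exists (Om : set phase) (W : phase -> R),
    [/\ Om z0, Om `<=` O, open Om, smooth_on Om (W : phase -> R^o)
      & forall z, Om z -> \row_i partial_snd i W z = al z].
Proof.
move=> oO sal Oz0 cl.
have : \forall z \near z0, O z by exact: open_nbhs_nbhs.
move=> /nbhs_ballP[r /= r0 rO]; pose u0 := z0.2; pose b : phase := (0, u0).
pose sg := seg phase_fst phase_snd b; pose D : set phase := ball z0 r.
have oD : open D by exact: ball_open.
have segO (z : phase) (t : R) : D z -> 0 <= t <= 1 -> O (sg t z).
  rewrite /D -ball_normE /= => zr /andP[t0 t1]; apply: rO; rewrite -ball_normE /=.
  (* In the maximum norm of the product, shrinking the coordinate difference by t while keeping the
     parameters cannot increase the distance to z0. *)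
  apply: le_lt_trans zr.
  have -> : z0 - sg t z = (z0.1 - z.1, t *: (z0.2 - z.2)).
    rewrite /sg /seg /b /u0 -[LHS]/(z0.1 - (z.1 + t *: 0 + (1 - t) *: 0),
      z0.2 - (0 + t *: z.2 + (1 - t) *: z0.2)).
    rewrite !scaler0 !addr0 add0r scalerBl scale1r scalerBr; congr (_, _).
    by rewrite opprD opprB addrCA [z0.2 + _]addrC subrK addrC.
  rewrite !prod_normE /= ge_max !le_max lexx normrZ ger0_norm//.
  by rewrite ler_piMl// orbT.
have sali i : smooth_on O ((fun y => al y 0 i) : phase -> R^o) by exact: smooth_entry.
pose F i := pint phase_fst phase_snd b 0 (fun y => al y 0 i).
pose W z : R := \sum_i (z.2 i 0 - u0 i 0) * F i z.
have sF i : smooth_on D (F i : phase -> R^o).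
  exact: (smooth_pint phase_coordE phase_coord_le phase_fst_le phase_snd_le 0
    oO oD segO (sali i)).
have sco i : smooth_on D ((fun z : phase => z.2 i 0 - u0 i 0) : phase -> R^o).
  apply: smoothD => //; last exact: smooth_cst.
  by apply: smooth_entry => //; exact: smooth_snd.
exists D, W; split => //.
- exact: ballxx.
- by apply: smooth_sum => // i; exact: smoothM.
move=> z Dz; apply/rowP => j; rewrite mxE /partial_snd.
set v : phase := (0, delta_mx j 0).
have Oz t := segO z t Dz.
have dco i : derivable ((fun z : phase => z.2 i 0 - u0 i 0) : phase -> R^o) z v.
  by apply: diff_derivable; exact: smooth_diff (sco i) Dz.
have dF i : derivable (F i : phase -> R^o) z v.
  by apply: diff_derivable; exact: smooth_diff (sF i) Dz.
have -> : W = \sum_i (fun z : phase => (z.2 i 0 - u0 i 0) * F i z).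
  by apply/funext => y; rewrite fct_sumE.
rewrite derive_sum; last by move=> i; exact: derivableM.
have dcoE i : 'D_v ((fun z : phase => z.2 i 0 - u0 i 0) : phase -> R^o) z = (i == j)%:R.
  have dsnd : differentiable ((fun z : phase => z.2 i 0) : phase -> R^o) z.
    by apply: (@smooth_diff _ _ _ D) Dz; apply: smooth_entry => //; exact: smooth_snd.
  rewrite deriveB; [|exact: diff_derivable|exact: derivable_cst].
  rewrite derive_cst subr0 -derive_entry; last exact: smooth_diff (@smooth_snd D) Dz.
  rewrite deriveE; last exact: smooth_diff (@smooth_snd D) Dz.
  rewrite (@diff_lin _ _ _ (snd : {linear phase -> _})); last by move=> y; exact: cvg_snd.
  by rewrite /= mxE eqxx andbT.
have dFE i : 'D_v (F i : phase -> R^o) z =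
    pint phase_fst phase_snd b 1 (partial_snd i (fun y => al y 0 j)) z.
  have sal1 := (smooth_onP _ _).1 (sali i) 1%N.
  have [_ ->] := pint_diff phase_coordE phase_coord_le phase_fst_le phase_snd_le 0 oO oD segO
    sal1 Dz.
  (* The direction v has no parameter component, so the term of weight 0 is a derivative in the
     direction 0 and only the term of weight t survives. *)
  transitivity (pint phase_fst phase_snd b 0 ('D_0 ((fun y => al y 0 i) : phase -> R^o)) z +
    pint phase_fst phase_snd b 1 ('D_v ((fun y => al y 0 i) : phase -> R^o)) z); first by [].
  rewrite [X in X + _](@eq_int01 _ _ (fun=> 0 * 0)); last first.
    by move=> t t01; rewrite derive0 !mulr0.
  rewrite (int01Z 0 (g := fun=> 0)) ?mul0r ?add0r; last by move=> t _; exact: cst_continuous.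
  by apply: pint_ext => t t01; rewrite -[LHS]/(partial_snd j _ _) cl//; exact: Oz.
under eq_bigr => i _ do rewrite deriveM// dcoE dFE.
rewrite big_split /= [X in _ + X](bigD1 j)//= eqxx [X in _ + (_ + X)]big1 ?addr0; last first.
  by move=> i /negPf ->; rewrite scaler0.
have cg m i : cont01 (fun t => t ^+ m * partial_snd i (fun y => al y 0 j) (sg t z)).
  have := (smooth_onP _ _).1 (smooth_derive (0, delta_mx i 0) (sali j)) 0%N.
  by move/cont01_seg; apply.
have ca : cont01 (fun t => t ^+ 0 * al (sg t z) 0 j).
  by have /cont01_seg := (smooth_onP _ _).1 (sali j) 0%N; apply.
transitivity (int01 (fun t => \sum_i (z.2 i 0 - u0 i 0) *
    (t ^+ 1 * partial_snd i (fun y => al y 0 j) (sg t z)) + t ^+ 0 * al (sg t z) 0 j)).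
  have cZ i : cont01 (fun t => (z.2 i 0 - u0 i 0) *
      (t ^+ 1 * partial_snd i (fun y => al y 0 j) (sg t z))).
    by move=> t t01; apply: continuousM; [exact: cst_continuous|exact: cg].
  rewrite int01D//; last exact: cont01_sum.
  rewrite int01_sum// -[F j z *: _]/(F j z * 1) mulr1; congr (_ + _).
  by apply: eq_bigr => i _; rewrite int01Z.
have sgE t : sg t z = t *: ((0, z.2 - u0) : phase) + (phase_fst z + b).
  rewrite /sg /seg /b -[LHS]/(z.1 + t *: 0 + (1 - t) *: 0, 0 + t *: z.2 + (1 - t) *: u0).
  rewrite -[RHS]/(t *: 0 + (z.1 + 0), t *: (z.2 - u0) + (0 + u0)).
  rewrite !scaler0 !addr0 !add0r scalerBl scale1r scalerBr; congr (_, _).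
  by rewrite -addrA [- _ + _]addrC.
have cg' : cont01 (fun t => \sum_i (z.2 i 0 - u0 i 0) *
    (t ^+ 1 * partial_snd i (fun y => al y 0 j) (sg t z)) + t ^+ 0 * al (sg t z) 0 j).
  move=> t t01; apply: continuousD; last exact: ca.
  apply: cont01_sum t t01 => i t t01.
  by apply: continuousM; [exact: cst_continuous|exact: cg].
have dG (t : R) : 0 <= t <= 1 -> is_derive t 1 ((fun t => t * al (sg t z) 0 j) : R -> R^o)
    (\sum_i (z.2 i 0 - u0 i 0) * (t ^+ 1 * partial_snd i (fun y => al y 0 j) (sg t z)) +
     t ^+ 0 * al (sg t z) 0 j).
  move=> t01.
  have dal : differentiable ((fun y => al y 0 j) : phase -> R^o)
      (t *: ((0, z.2 - u0) : phase) + (phase_fst z + b)).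
    by rewrite -sgE; apply: smooth_diff (sali j) _; exact: Oz.
  have := is_deriveM (is_derive_id t (1 : R)) (is_derive_line dal).
  move=> H; apply: is_derive_eq.
    rewrite (_ : (fun t => t * al (sg t z) 0 j) = id *
      (fun s : R => al (s *: ((0, z.2 - u0) : phase) + (phase_fst z + b)) 0 j)).
      exact: H.
    by apply/funext => s; rewrite sgE.
  rewrite -sgE snd_dirE derive_dirsum; last by rewrite sgE.
  rewrite expr1 expr0 mul1r -[X in _ + X]/(al (sg t z) 0 j * 1) mulr1; congr (_ + _).
  rewrite -[LHS]/(t * _) mulr_sumr; apply: eq_bigr => i _.
  by rewrite mulrCA !mxE.
rewrite (int01_FTC cg' dG) mul1r mul0r subr0 sgE scale1r; congr (al _ 0 j).
case: z {Dz Oz dco dF dcoE dFE cg ca cg' dG sgE} => c u.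
by rewrite -[LHS]/(0 + (c + 0), u - u0 + (0 + u0)) addr0 !add0r subrK.
Qed.

End Primitive.

(** * The tensor of a symmetry *)

Section Defect.
Context {R : realType} {n : nat}.
Notation point := 'cV[R]_n.+1.
Notation operator_field := (point -> 'M[R]_n.+1).
Implicit Types (D : set point) (L B C : operator_field) (t : point -> 'rV[R]_n.+1).

(* <L, B> on constant fields xi, eta; being a tensor, it is determined by them. *)
Definition defect L B (x xi eta : point) : point :=
  'D_(L x *m xi) B x *m eta - 'D_(B x *m eta) L x *m xi
  - L x *m ('D_xi B x *m eta) + B x *m ('D_eta L x *m xi).

Lemma mxDij (p q : nat) (a b : 'M[R]_(p, q)) i j : (a + b) i j = a i j + b i j.
Proof. by rewrite mxE. Qed.
Lemma mxNij (p q : nat) (a : 'M[R]_(p, q)) i j : (- a) i j = - a i j.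
Proof. by rewrite mxE. Qed.
Lemma mxZij (p q : nat) k (a : 'M[R]_(p, q)) i j : (k *: a) i j = k * a i j.
Proof. by rewrite mxE. Qed.
Lemma mx00_tr (a : 'M[R]_1) : a^T 0 0 = a 0 0. Proof. by rewrite mxE. Qed.

Lemma mulmx_delta00 (p q : nat) (a : 'M[R]_(p.+1, q)) j :
  (a *m delta_mx j (0 : 'I_1)) 0 0 = a 0 j.
Proof. by rewrite -colE mxE. Qed.

Lemma lie_bracket_app L M x (xi eta : point) : differentiable L x -> differentiable M x ->
  lie_bracket (op_app L (cst xi)) (op_app M (cst eta)) x =
  'D_(L x *m xi) M x *m eta - 'D_(M x *m eta) L x *m xi.
Proof.
move=> dL dM; rewrite /lie_bracket /op_app /=.
by rewrite !derive_mulmx ?derive_cst ?mulmx0 ?addr0//; exact: differentiable_cst.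
Qed.

Lemma lie_bracket_cst_app M x (xi eta : point) : differentiable M x ->
  lie_bracket (cst xi) (op_app M (cst eta)) x = 'D_xi M x *m eta.
Proof.
move=> dM; rewrite /lie_bracket /op_app /= derive_cst subr0.
by rewrite derive_mulmx ?derive_cst ?mulmx0 ?addr0//; exact: differentiable_cst.
Qed.

Lemma lie_bracket_app_cst L x (xi eta : point) : differentiable L x ->
  lie_bracket (op_app L (cst xi)) (cst eta) x = - ('D_eta L x *m xi).
Proof.
move=> dL; rewrite /lie_bracket /op_app /= derive_cst sub0r.
by rewrite derive_mulmx ?derive_cst ?mulmx0 ?addr0//; exact: differentiable_cst.
Qed.

Lemma strong_symmetry_defect D L M x : smooth_on D L -> strong_symmetry D L M -> D x ->
  forall xi eta, defect L M x xi eta = 0.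
Proof.
move=> sL [sM LM sym] Dx xi eta.
have dL := smooth_diff sL Dx; have dM := smooth_diff sM Dx.
have := sym (cst xi) (cst eta) (@smooth_cst _ _ _ _ _) (@smooth_cst _ _ _ _ _) x Dx.
rewrite lie_bracket_app// lie_bracket_cst_app// lie_bracket_app_cst//.
rewrite {1}/lie_bracket !derive_cst subr0 mulmx0 add0r mulmxN opprK.
by [].
Qed.

Lemma nijenhuis_symmetry D L : smooth_on D L -> nijenhuis D L -> strong_symmetry D L L.
Proof.
move=> sL nL; split; [exact: sL|by []|] => xi eta sxi seta y Dy.
have H := nL xi eta sxi seta y Dy; have E : L y ^+ 2 = L y *m L y := erefl.
rewrite E in H; rewrite [LHS]addrAC; exact: H.
Qed.

(** The Leibniz rule: the terms containing ['D_(C x *m eta) L] cancel, and commutation at x turns L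
    B 'D_xi C into B L 'D_xi C. *)
Lemma defect_mulmx L B C x xi eta : differentiable B x -> differentiable C x ->
  L x *m B x = B x *m L x ->
  defect L (fun y => B y *m C y) x xi eta =
  defect L B x xi (C x *m eta) + B x *m defect L C x xi eta.
Proof.
move=> dB dC LB; rewrite /defect !derive_mulmx//.
rewrite -(mulmxA (B x)).
move: ('D_(L x *m xi) B x) ('D_(L x *m xi) C x) ('D_xi B x) ('D_xi C x) => b c b' c'.
move: ('D_(B x *m (C x *m eta)) L x) ('D_(C x *m eta) L x) ('D_eta L x) => l l' l''.
rewrite !(mulmxDl, mulmxDr, mulmxN, mulmxA, LB); apply/colP => i.
by rewrite !(mxDij, mxNij); ring.
Qed.

Lemma mulmx_deltaij (p q : nat) (a : 'M[R]_(p, q)) i j : (a *m delta_mx j (0 : 'I_1)) i 0 = a i j.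
Proof. by rewrite -colE mxE. Qed.

Lemma defect_ext L B C x xi eta : {near x, B =1 C} -> defect L B x xi eta = defect L C x xi eta.
Proof.
move=> BC; rewrite /defect (near_eq_derive _ BC) (near_eq_derive _ BC).
by rewrite (nbhs_singleton BC).
Qed.

(** For fixed xi the tensor becomes an operator T acting on eta, so that one can ask whether it
    commutes with L. *)
Lemma defect_linear L B x xi : differentiable L x ->
  exists T : 'M[R]_n.+1, forall eta, defect L B x xi eta = T *m eta.
Proof.
move=> dL; pose T1 : 'M[R]_n.+1 := \matrix_(i, j) ('D_(delta_mx j 0) L x *m xi) i 0.
have T1E eta : 'D_eta L x *m xi = T1 *m eta.
  rewrite [in LHS](matrix_sum_delta eta); under eq_bigr do rewrite big_ord1.
  rewrite derive_dirsum// mulmx_suml; apply/colP => i; rewrite summxE [RHS]mxE.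
  by apply: eq_bigr => j _; rewrite -scalemxAl mxZij [T1 i j]mxE mulrC.
exists ('D_(L x *m xi) B x - T1 *m B x - L x *m 'D_xi B x + B x *m T1) => eta.
rewrite /defect (T1E (B x *m eta)) (T1E eta).
by move: ('D_(L x *m xi) B x) ('D_xi B x) => b b'; rewrite !mulmxDl !mulNmx !mulmxA.
Qed.

Lemma defectD L B C x xi eta : differentiable L x ->
  differentiable B x -> differentiable C x ->
  defect L (fun y => B y + C y) x xi eta = defect L B x xi eta + defect L C x xi eta.
Proof.
move=> dL dB dC; rewrite /defect !deriveD; try exact: diff_derivable.
have -> : 'D_((B x + C x) *m eta) L x = 'D_(B x *m eta) L x + 'D_(C x *m eta) L x.
  by rewrite mulmxDl -[X in X + _]scale1r derive_linear// scale1r.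
move: ('D_(L x *m xi) B x) ('D_(L x *m xi) C x) ('D_xi B x) ('D_xi C x) => b c b' c'.
move: ('D_(B x *m eta) L x) ('D_(C x *m eta) L x) ('D_eta L x) => l l' l''.
rewrite !(mulmxDl, mulmxDr, mulmxN); apply/colP => i.
by rewrite !(mxDij, mxNij); ring.
Qed.

(** The correction dk(L xi) B eta - dk(xi) L B eta is what turns the symmetry equation for sum_a k_a
    M_a into an equation for the differentials dk_a. *)
Lemma defectZ L B (k : point -> R) x xi eta : differentiable L x ->
  differentiable B x -> differentiable (k : point -> R^o) x ->
  defect L (fun y => k y *: B y) x xi eta = k x *: defect L B x xi eta +
  ('D_(L x *m xi) (k : point -> R^o) x *: (B x *m eta) -
   'D_xi (k : point -> R^o) x *: (L x *m (B x *m eta))).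
Proof.
move=> dL dB dk; rewrite /defect.
rewrite (derive_scalemx _ dk dB).2 (derive_scalemx _ dk dB).2.
have -> : 'D_((k x *: B x) *m eta) L x = k x *: 'D_(B x *m eta) L x.
  by rewrite -scalemxAl (deriveE _ dL) linearZ -(deriveE _ dL).
move: ('D_(L x *m xi) B x) ('D_xi B x) => b b'.
move: ('D_(L x *m xi) (k : point -> R^o) x) ('D_xi (k : point -> R^o) x) => k1 k2.
move: ('D_(B x *m eta) L x) ('D_eta L x) => l l'.
rewrite !mulmxDl !mulmxDr -!scalemxAl -!scalemxAr; apply/colP => i.
by rewrite !(mxDij, mxNij, mxZij); ring.
Qed.

Lemma defect_sum L (I : Type) (r : seq I) (k : I -> point -> R) (B : I -> operator_field)
    x xi eta : differentiable L x -> (forall i, differentiable (B i) x) ->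
  (forall i, differentiable (k i : point -> R^o) x) ->
  defect L (fun y => \sum_(i <- r) k i y *: B i y) x xi eta =
  \sum_(i <- r) (k i x *: defect L (B i) x xi eta +
  ('D_(L x *m xi) (k i : point -> R^o) x *: (B i x *m eta) -
   'D_xi (k i : point -> R^o) x *: (L x *m (B i x *m eta)))).
Proof.
move=> dL dB dk.
have dkB i := (derive_scalemx 0 (dk i) (dB i)).1.
suff [] : differentiable (fun y => \sum_(i <- r) k i y *: B i y) x /\
    defect L (fun y => \sum_(i <- r) k i y *: B i y) x xi eta =
    \sum_(i <- r) defect L (fun y => k i y *: B i y) x xi eta.
  by move=> _ ->; apply: eq_bigr => i _; rewrite defectZ.
elim: r => [|i r [dS IH]].
  rewrite (_ : (fun y => _) = cst 0); last by apply/funext => y; rewrite big_nil.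
  split; first exact: differentiable_cst.
  by rewrite /defect !derive_cst /= !mul0mx derive0 mulmx0 !mul0mx !subr0 addr0 big_nil.
rewrite (_ : (fun y => _) = (fun y => k i y *: B i y + \sum_(i <- r) k i y *: B i y)); last first.
  by apply/funext => y; rewrite big_cons.
by split; [exact: differentiableD|rewrite defectD// IH big_cons].
Qed.

Definition closed_at (al : point -> 'rV[R]_n.+1) (x : point) : Prop :=
  forall xi eta : point, ('D_xi al x *m eta) 0 0 = ('D_eta al x *m xi) 0 0.

Definition jac (al : point -> 'rV[R]_n.+1) (x : point) : 'M[R]_n.+1 :=
  \matrix_i 'D_(delta_mx i 0) al x.

Lemma jacE al x xi : differentiable al x -> 'D_xi al x = xi^T *m jac al x.
Proof.
move=> dal; rewrite mulmx_sum_row [in LHS](matrix_sum_delta xi).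
under eq_bigr do rewrite big_ord1.
by rewrite derive_dirsum//; apply: eq_bigr => i _; rewrite rowK mxE.
Qed.

Lemma closed_atP al x : differentiable al x -> closed_at al x <-> (jac al x)^T = jac al x.
Proof.
move=> dal; split=> [cl|sym xi eta].
  apply/matrixP => i j; have := cl (delta_mx i 0) (delta_mx j 0).
  by rewrite !jacE// !trmx_delta -!rowE -!colE !mxE.
rewrite !jacE// -[RHS]mx00_tr !trmx_mul trmxK sym mulmxA.
by [].
Qed.

Lemma closed_at_entries al x : differentiable al x ->
  closed_at al x <-> forall i j : 'I_n.+1,
    'D_(delta_mx i 0) (fun y => al y 0 j) x = 'D_(delta_mx j 0) (fun y => al y 0 i) x.
Proof.
move=> dal; split=> [cl i j|cl].
  have := cl (delta_mx i 0) (delta_mx j 0); rewrite !mulmx_delta00.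
  rewrite (derive_entry (delta_mx i 0) 0 j dal) (derive_entry (delta_mx j 0) 0 i dal).
  exact: id.
apply/closed_atP => //; apply/matrixP => i j.
rewrite [LHS]mxE [LHS]mxE [RHS]mxE.
rewrite (derive_entry (delta_mx j 0) 0 i dal) (derive_entry (delta_mx i 0) 0 j dal).
exact: cl.
Qed.

(* Over the closed forms t and tL the tensor <L, B> is the obstruction to
   d(tLB)(xi, eta) = d(tB)(L xi, eta).  When it vanishes, d(tB) is an
   antisymmetric form for which L is self-adjoint, hence zero. *)
Lemma closed_mulmx D t L B s x : open D -> D x ->
  differentiable t x -> differentiable L x -> differentiable B x ->
  (forall y, D y -> L y *m B y = B y *m L y) ->
  cyc_mx s (L x) \in unitmx ->
  (forall xi eta, defect L B x xi eta = 0) ->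
  closed_at t x -> closed_at (fun y => t y *m L y) x ->
  closed_at (fun y => t y *m B y) x /\ closed_at (fun y => t y *m L y *m B y) x.
Proof.
move=> oD Dx dt dL dB LB us dfct ct ctL.
have dtB := differentiable_mulmx dt dB; have dtL := differentiable_mulmx dt dL.
have dtLB := differentiable_mulmx dtL dB.
have LBx := LB x Dx.
have key xi eta : ('D_xi (fun y => t y *m L y *m B y) x *m eta) 0 0 -
      ('D_eta (fun y => t y *m L y *m B y) x *m xi) 0 0 =
    ('D_(L x *m xi) (fun y => t y *m B y) x *m eta) 0 0 -
      ('D_eta (fun y => t y *m B y) x *m (L x *m xi)) 0 0.
  have -> : 'D_eta (fun y => t y *m L y *m B y) x = 'D_eta (fun y => t y *m B y *m L y) x.
    apply: near_eq_derive; near=> y; rewrite -mulmxA LB ?mulmxA//.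
    by near: y; exact: open_nbhs_nbhs.
  (* Three scalar relations whose linear combination gives the identity: dt = 0 on (L xi, B eta),
     d(tL) = 0 on (xi, B eta), and t applied to the vanishing tensor. *)
  have H1 := ct (L x *m xi) (B x *m eta).
  have H2 := ctL xi (B x *m eta).
  have H3 := congr1 (fun w => (t x *m w) 0 0) (dfct xi eta).
  rewrite mulmx0 [RHS]mxE /defect in H3.
  rewrite !(derive_mulmx _ dt dL) in H2.
  rewrite (derive_mulmx _ dtL dB) (derive_mulmx _ dtB dL) (derive_mulmx _ dt dL).
  rewrite (derive_mulmx _ dt dB) (derive_mulmx _ dt dB).
  move: H1 H2 H3 {dfct ct ctL dtB dtL dtLB dt dL dB LB us}.
  move: ('D_(L x *m xi) t x) ('D_xi t x) ('D_eta t x) ('D_(B x *m eta) t x) => t1 t2 t3 t4.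
  move: ('D_(L x *m xi) B x) ('D_xi B x) ('D_eta B x) => b1 b2 b3.
  move: ('D_(B x *m eta) L x) ('D_xi L x) ('D_eta L x) => l1 l2 l3.
  rewrite !(mulmxDl, mulmxDr, mulmxN) -!mulmxA !(mxDij, mxNij).
  by move=> H1 H2 H3; lra.
(* The left-hand side of [key] changes sign when xi and eta are exchanged; comparing both versions
   moves L from one argument of d(tB) to the other. *)
have aux (a b c d c' d' : R) : a - b = c - d -> b - a = c' - d' -> d' - c' = c - d.
  by move=> H1 H2; lra.
have anti xi eta : ('D_xi (fun y => t y *m B y) x *m (L x *m eta)) 0 0 -
      ('D_(L x *m eta) (fun y => t y *m B y) x *m xi) 0 0 =
    ('D_(L x *m xi) (fun y => t y *m B y) x *m eta) 0 0 -
      ('D_eta (fun y => t y *m B y) x *m (L x *m xi)) 0 0.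
  exact: aux (key xi eta) (key eta xi).
pose J := jac (fun y => t y *m B y) x; pose O := J - J^T.
have OE (xi eta : point) : (xi^T *m O *m eta) 0 0 =
    ('D_xi (fun y => t y *m B y) x *m eta) 0 0 - ('D_eta (fun y => t y *m B y) x *m xi) 0 0.
  rewrite !jacE// -/J /O mulmxBr mulmxBl mxDij mxNij; congr (_ - _).
  by rewrite -[LHS]mx00_tr !trmx_mul !trmxK mulmxA.
have LO : (L x)^T *m O = O *m L x.
  apply/matrixP => i j; have := anti (delta_mx i 0) (delta_mx j 0).
  rewrite -OE -OE trmx_mul !mulmxA -!(mulmxA _ _ O) -(mulmxA _ O) trmx_delta.
  by rewrite -!rowE -!colE !mxE.
have O0 : O = 0.
  have trJ i j : J^T i j = J j i by rewrite mxE.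
  apply/matrixP => i j; have H := congr1 (fun A : 'M[R]_n.+1 => A i j) (selfadj_sym us LO).
  rewrite /= [LHS]mxE /O !(mxDij, mxNij) !trJ in H.
  rewrite [RHS]mxE /O mxDij mxNij trJ.
  by move: (J i j) (J j i) H => p q H; lra.
have ctB : closed_at (fun y => t y *m B y) x.
  by apply/closed_atP => //; apply/esym/subr0_eq.
split; [exact: ctB|move=> xi eta; apply: subr0_eq; rewrite key].
by rewrite -OE O0 mulmx0 mul0mx mxE.
Unshelve. all: by end_near. Qed.

End Defect.

(** * Conservation laws *)

Section ConservationLaw.
Context {R : realType} {n : nat} (D : set 'cV[R]_n.+1)
  (L : 'cV[R]_n.+1 -> 'M[R]_n.+1) (f : 'cV[R]_n.+1 -> R).
Notation point := 'cV[R]_n.+1.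
Notation operator_field := (point -> 'M[R]_n.+1).
Implicit Types (B C M U : operator_field) (x y : point) (p q : 'rV[R]_n.+1).

Lemma smooth_exp k : open D -> smooth_on D L -> smooth_on D (fun y => L y ^+ k).
Proof.
move=> oD sL; elim: k => [|k IH]; first exact: smooth_cst.
rewrite (_ : (fun y => _) = fun y => L y *m L y ^+ k); first exact: smooth_mulmx.
by apply/funext => y; rewrite exprS.
Qed.

Lemma smooth_dform : open D -> smooth_on D (f : point -> R^o) -> smooth_on D (dform f).
Proof.
move=> oD sf; apply/smooth_mxP => // i j.
rewrite (_ : (fun y => _) = 'D_(delta_mx j 0) (f : point -> R^o)); first exact: smooth_derive.
by apply/funext => y; rewrite mxE.
Qed.

Lemma regular_law_unit x : regular_law D L f -> D x -> cyc_mx (dform f x) (L x) \in unitmx.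
Proof.
move=> reg Dx; rewrite -row_free_unit -kermx_eq0; apply/rowV0P => v /sub_kermxP vC.
have sz : size [seq dform f x *m L x ^+ k | k <- iota 0 n.+1] = n.+1.
  by rewrite size_map size_iota.
have /freeP fr : free (Tuple (introT eqP sz)) by exact: reg.
apply/rowP => i; rewrite mxE; apply: (fr (v 0)).
rewrite -[RHS]vC [RHS]mulmx_sum_row; apply: eq_bigr => k _; congr (_ *: _).
by rewrite row_cyc_mx (nth_map 0%N) ?size_iota// nth_iota.
Qed.

Hypotheses (oD : open D) (sL : smooth_on D L) (nL : nijenhuis D L)
  (cf : conservation_law D L f) (reg : regular_law D L f).

Let sth : smooth_on D (dform f). Proof. by apply: smooth_dform => //; case: cf. Qed.
Let uC x : D x -> cyc_mx (dform f x) (L x) \in unitmx. Proof. exact: regular_law_unit. Qed.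

Lemma closed_dform x : D x -> closed_at (dform f) x.
Proof.
move=> Dx; have [sf _] := cf; apply/closed_at_entries; first exact: smooth_diff sth Dx.
move=> i j.
rewrite (_ : (fun y => dform f y 0 j) = 'D_(delta_mx j 0) (f : point -> R^o)); last first.
  by apply/funext => y; rewrite mxE.
rewrite (_ : (fun y => dform f y 0 i) = 'D_(delta_mx i 0) (f : point -> R^o)); last first.
  by apply/funext => y; rewrite mxE.
apply: derive_sym.
- near=> y; apply: smooth_diff sf _; near: y; exact: open_nbhs_nbhs.
- exact: smooth_diff (smooth_derive _ sf) Dx.
- exact: smooth_diff (smooth_derive _ sf) Dx.
Unshelve. all: by end_near. Qed.

Lemma closed_dformL x : D x -> closed_at (fun y => dform f y *m L y) x.
Proof.
move=> Dx; have [_ cl] := cf; apply/closed_at_entries; last exact: cl.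
by apply: differentiable_mulmx; [exact: smooth_diff sth Dx|exact: smooth_diff sL Dx].
Qed.

Let nijenhuis_defect0 x : D x -> forall xi eta, defect L L x xi eta = 0.
Proof. exact: strong_symmetry_defect sL (nijenhuis_symmetry sL nL). Qed.

(** Closedness of df L^k and df L^(k+1) gives that of df L^(k+2), which is t L B with t = df L^k and
    B = L; hence the induction on consecutive pairs. These forms are the differentials of the
    companion coordinates. *)
Lemma closed_dformX k x : D x -> closed_at (fun y => dform f y *m L y ^+ k) x.
Proof.
have E j : (fun y => dform f y *m L y ^+ j.+1) = (fun y => dform f y *m L y ^+ j *m L y).
  by apply/funext => y; rewrite exprSr -mulmxE mulmxA.
suff : forall x, D x -> closed_at (fun y => dform f y *m L y ^+ k) x /\
    closed_at (fun y => dform f y *m L y ^+ k.+1) x.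
  by move=> H Dx; have [] := H x Dx.
elim: k {x} => [|k IH] x Dx.
  rewrite E (_ : (fun y => _ *m _ ^+ 0) = dform f); last first.
    by apply/funext => y; rewrite expr0 mulmx1.
  rewrite (_ : (fun y => _) = (fun y => dform f y *m L y)); last first.
    by apply/funext => y; rewrite expr0 mulmx1.
  by split; [exact: closed_dform|exact: closed_dformL].
have [c1 c2] := IH x Dx; split; first exact: c2.
rewrite E in c2.
rewrite (_ : (fun y => _) = (fun y => dform f y *m L y ^+ k *m L y *m L y)); last first.
  by apply/funext => y; rewrite exprSr exprSr -!mulmxE !mulmxA.
have dL := smooth_diff sL Dx.
have dt : differentiable (fun y => dform f y *m L y ^+ k) x.
  apply: differentiable_mulmx; first exact: smooth_diff sth Dx.
  exact: smooth_diff (smooth_exp k oD sL) Dx.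
(* Where L is singular df L^k need not be cyclic; the cyclic covector s is therefore df and not the
   form t. *)
by have [] := closed_mulmx oD Dx dt dL dL (fun _ _ => erefl) (uC Dx) (nijenhuis_defect0 Dx) c1 c2.
Qed.

Lemma closed_dform_sym (O : set point) B x : open O -> O `<=` D -> O x -> smooth_on O B ->
  (forall y, O y -> L y *m B y = B y *m L y) -> (forall xi eta, defect L B x xi eta = 0) ->
  closed_at (fun y => dform f y *m B y) x.
Proof.
move=> oO OD Ox sB LB dB; have Dx := OD x Ox.
by have [] := closed_mulmx oO Ox (smooth_diff sth Dx) (smooth_diff sL Dx) (smooth_diff sB Ox)
  LB (uC Dx) dB (closed_dform Dx) (closed_dformL Dx).
Qed.

Lemma defectX k x xi eta : D x -> defect L (fun y => L y ^+ k) x xi eta = 0.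
Proof.
move=> Dx; have dL := smooth_diff sL Dx; elim: k xi eta => [|k IH] xi eta.
  rewrite /defect (_ : (fun y => L y ^+ 0) = cst 1); last by [].
  by rewrite !derive_cst !mul0mx mulmx0 !mul1mx sub0r subr0 addNr.
rewrite (_ : (fun y => _) = fun y => L y *m L y ^+ k); last first.
  by apply/funext => y; rewrite exprS.
rewrite defect_mulmx//; last exact: smooth_diff (smooth_exp k oD sL) Dx.
by rewrite IH mulmx0 addr0 (nijenhuis_defect0 Dx).
Qed.

(* If B^2 satisfies the symmetry equation, then T = <L, B>(xi, .) commutes with
   L, hence with B, and the Leibniz rule gives 0 = <L, B^2> = 2 B T. *)
Lemma defect_root (O : set point) B x : open O -> O `<=` D -> O x -> smooth_on O B ->
  (forall y, O y -> L y *m B y = B y *m L y) -> B x \in unitmx ->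
  (forall xi eta, defect L (fun y => B y *m B y) x xi eta = 0) ->
  forall xi eta, defect L B x xi eta = 0.
Proof.
move=> oO OD Ox sB LB uB dBB xi eta; have Dx := OD x Ox.
have dL := smooth_diff sL Dx; have dB := smooth_diff sB Ox; have LBx := LB x Ox.
have d0 := nijenhuis_defect0 Dx.
have [T TE] := defect_linear B xi dL.
(* L B and B L have the same tensor; expanding both by the Leibniz rule with <L, L> = 0 gives L T on
   one side and T L on the other. *)
have TL : L x *m T = T *m L x.
  apply/matrixP => i j; rewrite -[LHS]mulmx_deltaij -[RHS]mulmx_deltaij -!mulmxA -!TE.
  have := defect_mulmx xi (delta_mx j 0) dL dB (erefl : L x *m L x = L x *m L x).
  rewrite d0 add0r => <-.
  have E : {near x, (fun y => L y *m B y) =1 (fun y => B y *m L y)}.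
    by near=> y; apply: LB; near: y; exact: open_nbhs_nbhs.
  rewrite (@defect_ext _ _ L _ _ x xi _ E).
  by rewrite defect_mulmx// d0 mulmx0 addr0.
have TB := cyc_comm (uC Dx) TL LBx.
have BT : B x *m T = 0.
  apply/matrixP => i j; rewrite -[LHS]mulmx_deltaij -mulmxA [RHS]mxE.
  have := dBB xi (delta_mx j 0); rewrite defect_mulmx// !TE mulmxA TB.
  rewrite -mulmxA -mulr2n => /eqP; rewrite -scaler_nat scaler_eq0 pnatr_eq0 /= => /eqP ->.
  by rewrite mxE.
by rewrite TE -[T](mulKmx uB) BT mulmx0 mul0mx.
Unshelve. all: by end_near. Qed.

End ConservationLaw.

(** * The Hamiltonians *)

Section HamiltonianFamily.
Context {R : realType} {n : nat} (D : set 'cV[R]_n.+1)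
  (L : 'cV[R]_n.+1 -> 'M[R]_n.+1) (f : 'cV[R]_n.+1 -> R).
Notation point := 'cV[R]_n.+1.
Notation operator_field := (point -> 'M[R]_n.+1).
Implicit Types (x y : point) (p q : 'rV[R]_n.+1).

Lemma cyc_op_linear (t : 'rV[R]_n.+1) (A : 'M[R]_n.+1) a p q :
  cyc_op t A (a *: p + q) = a *: cyc_op t A p + cyc_op t A q.
Proof.
rewrite /cyc_op scaler_sumr -big_split; apply: eq_bigr => k _ /=.
by rewrite mulmxDl -scalemxAl mxDij mxZij scalerDl scalerA.
Qed.

Lemma checkPE p x : checkP L f p x = cyc_op (dform f x) (L x) p. Proof. by []. Qed.

Lemma checkP_comm p x : L x *m checkP L f p x = checkP L f p x *m L x.
Proof. exact: cyc_op_comm. Qed.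

Lemma checkPD p q x : checkP L f (p + q) x = checkP L f p x + checkP L f q x.
Proof. by have := cyc_op_linear (dform f x) (L x) 1 p q; rewrite !scale1r. Qed.

Lemma checkP0 x : checkP L f 0 x = 0.
Proof. by apply: (addrI (checkP L f 0 x)); rewrite -checkPD !addr0. Qed.

Lemma checkPZ a p x : checkP L f (a *: p) x = a *: checkP L f p x.
Proof. by have := cyc_op_linear (dform f x) (L x) a p 0; rewrite -!checkPE checkP0 !addr0. Qed.

Lemma checkP_sum p x : checkP L f p x = \sum_j p 0 j *: checkP L f (delta_mx 0 j) x.
Proof.
rewrite [in LHS](matrix_sum_delta p) big_ord1.
apply: (big_ind2 (fun r B => checkP L f r x = B)) => [|r B r' B' <- <-|j _].
- exact: checkP0.
- exact: checkPD.
- exact: checkPZ.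
Qed.

Hypothesis (reg : regular_law D L f).
Let uC x : D x -> cyc_mx (dform f x) (L x) \in unitmx. Proof. exact: regular_law_unit. Qed.

Lemma checkP_of_comm x (B : 'M[R]_n.+1) : D x -> L x *m B = B *m L x ->
  checkP L f (dform f x *m B) x = B.
Proof. by move=> Dx LB; rewrite checkPE -cyc_opE//; exact: uC. Qed.

Lemma checkP_commute x p q : D x ->
  checkP L f p x *m checkP L f q x = checkP L f q x *m checkP L f p x.
Proof. by move=> Dx; apply: (cyc_comm (uC Dx)); exact: checkP_comm. Qed.

Lemma checkP_dformE x : D x -> checkP L f (dform f x) x = 1.
Proof.
move=> Dx; have := @checkP_of_comm x 1%:M Dx; rewrite !mulmx1 mul1mx; exact.
Qed.

Lemma checkP_mulL p x : D x -> checkP L f (p *m L x) x = checkP L f p x *m L x.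
Proof.
move=> Dx; rewrite -{1}(checkP_dform p reg Dx) -mulmxA checkP_of_comm//.
by rewrite mulmxA checkP_comm.
Qed.

(** Both sides are df P(p) P(q), with P = checkP: the commutative product of operators carried over
    to covectors. It makes the forms g_a symmetric. *)
Lemma mul_checkPC x p q : D x -> p *m checkP L f q x = q *m checkP L f p x.
Proof.
move=> Dx; rewrite -{1}(checkP_dform p reg Dx) -{2}(checkP_dform q reg Dx).
by rewrite -!mulmxA checkP_commute.
Qed.

Variables (M : 'I_n.+1 -> operator_field) (U : operator_field).
Hypotheses (bM : sym_basis D L M) (sU : strong_symmetry D L U).

(** With rows df M_a, its inverse turns the covector df B of an operator B commuting with L into the
    coefficients of B in the basis M_a. *)
Definition sym_frame x : 'M[R]_n.+1 := \matrix_(a, j) (dform f x *m M a x) 0 j.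

Lemma row_sym_frame x a : row a (sym_frame x) = dform f x *m M a x.
Proof. by apply/rowP => j; rewrite !mxE. Qed.

Lemma sym_basis_comm a x : D x -> L x *m M a x = M a x *m L x.
Proof. by move=> Dx; have [/(_ a)[_ + _] _] := bM; exact. Qed.

Lemma comm_lincomb x (c : 'I_n.+1 -> R) : D x ->
  L x *m (\sum_a c a *: M a x) = (\sum_a c a *: M a x) *m L x.
Proof.
move=> Dx; rewrite mulmx_sumr mulmx_suml; apply: eq_bigr => a _.
by rewrite -scalemxAl -scalemxAr sym_basis_comm.
Qed.

Lemma dform_lincomb x (c : 'rV[R]_n.+1) :
  dform f x *m (\sum_a c 0 a *: M a x) = c *m sym_frame x.
Proof.
rewrite mulmx_sumr mulmx_sum_row; apply: eq_bigr => a _.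
by rewrite -scalemxAr row_sym_frame.
Qed.

Lemma sym_frame_unit x : D x -> sym_frame x \in unitmx.
Proof.
move=> Dx; rewrite -row_free_unit -kermx_eq0; apply/rowV0P => c /sub_kermxP.
rewrite -dform_lincomb => /(cyc_inj0 (uC Dx) (comm_lincomb _ Dx)) c0.
have [_ /(_ x Dx)/free_enumP fr] := bM.
by apply/rowP => i; rewrite mxE; exact: (fr (c 0)).
Qed.

Lemma lincomb_inj x (c d : 'I_n.+1 -> R) : D x ->
  \sum_a c a *: M a x = \sum_a d a *: M a x -> c =1 d.
Proof.
move=> Dx; have E (e : 'I_n.+1 -> R) : \sum_a e a *: M a x = \sum_a (\row_b e b) 0 a *: M a x.
  by apply: eq_bigr => a _; rewrite mxE.
rewrite (E c) (E d) => /(congr1 (mulmx (dform f x))); rewrite !dform_lincomb.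
move=> /(congr1 (fun A => A *m invmx (sym_frame x))); rewrite !mulmxK ?sym_frame_unit//.
by move=> /rowP cd a; have := cd a; rewrite !mxE.
Qed.

Lemma lincomb_exists x (B : 'M[R]_n.+1) : D x -> L x *m B = B *m L x ->
  \sum_a (dform f x *m B *m invmx (sym_frame x)) 0 a *: M a x = B.
Proof.
move=> Dx LB; apply: (cyc_inj (uC Dx)) => //; first exact: comm_lincomb.
by rewrite dform_lincomb mulmxKV// sym_frame_unit.
Qed.

Lemma quadE (g : 'M[R]_n.+1) p :
  \sum_s \sum_q g s q * p 0 s * p 0 q = (p *m g *m p^T) 0 0.
Proof.
rewrite [RHS]mxE exchange_big; apply: eq_bigr => q _ /=.
rewrite mxE [p^T _ _]mxE big_distrl; apply: eq_bigr => s _ /=.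
by rewrite [g s q * _]mulrC.
Qed.

Lemma quad_hamE (g : operator_field) V (z : 'rV[R]_n.+1 * point) :
  quad_ham g V z = 2^-1 * (z.1 *m g z.2 *m z.1^T) 0 0 + V z.2.
Proof. by rewrite /quad_ham quadE. Qed.

Section Smoothness.
Hypotheses (oD : open D) (sL : smooth_on D L) (sf : smooth_on D (f : point -> R^o)).

Lemma smooth_scalemx (V : normedModType R) (O : set V) (k l : nat)
    (c : V -> R) (F : V -> 'M[R]_(k, l)) :
  open O -> smooth_on O (c : V -> R^o) -> smooth_on O F -> smooth_on O (fun w => c w *: F w).
Proof.
move=> oO sc sF; apply/smooth_mxP => // i j; under eq_fun do rewrite mxE.
by apply: smoothM => //; exact: smooth_entry.
Qed.

Lemma smooth_coframe : smooth_on D (companion_coframe L f).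
Proof.
apply/smooth_mxP => // i j; under eq_fun do rewrite mxE.
apply: smooth_entry => //; apply: smooth_mulmx => //; first exact: smooth_dform.
exact: smooth_exp.
Qed.

Lemma smooth_inv_coframe : smooth_on D (fun y => invmx (companion_coframe L f y)).
Proof. by apply: smooth_invmx => //; exact: smooth_coframe. Qed.

Lemma smooth_checkP p : smooth_on D (checkP L f p).
Proof.
apply: smooth_sum => // k; apply: smooth_scalemx => //; last exact: smooth_exp.
apply: smooth_entry => //; apply: smooth_mulmx => //; first exact: smooth_cst.
exact: smooth_inv_coframe.
Qed.

Lemma smooth_sym_frame : smooth_on D sym_frame.
Proof.
apply/smooth_mxP => // a j; under eq_fun do rewrite mxE.
apply: smooth_entry => //; apply: smooth_mulmx => //; first exact: smooth_dform.
by have [/(_ a)[]] := bM.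
Qed.

Lemma ham_family_exists : exists g V, is_ham_family D L f M U g V.
Proof.
pose W x := invmx (sym_frame x).
have sW : smooth_on D W.
  by apply: smooth_invmx => //; [exact: sym_frame_unit|exact: smooth_sym_frame].
(* The coefficients of P(p)^2 + U in the basis M_a are the entries of df (P(p)^2 + U) times the
   inverse frame W. Since df P(p) = p, the quadratic part is p P(p) W; the factor 2 compensates the
   1/2 in [quad_ham]. *)
exists (fun a x => \matrix_(s, q) (2 * (checkP L f (delta_mx 0 q) x *m W x) s a)).
exists (fun a x => (dform f x *m U x *m W x) 0 a).
have E x (a : 'I_n.+1) p q : (p *m (\matrix_(s, q) (2 * (checkP L f (delta_mx 0 q) x *m W x) s a))
    *m q^T) 0 0 = 2 * (p *m checkP L f q x *m W x) 0 a.
  rewrite checkP_sum mulmx_sumr mulmx_suml summxE mulr_sumr [LHS]mxE.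
  apply: eq_bigr => j _; rewrite -scalemxAr -scalemxAl mxZij [q^T _ _]mxE mulrCA mulrC.
  congr (_ * _); rewrite -mulmxA [LHS]mxE [X in _ = _ * X]mxE mulr_sumr.
  by apply: eq_bigr => s _; rewrite [X in _ * X]mxE mulrCA.
split.
- move=> a; apply/smooth_mxP => // s q; under eq_fun do rewrite mxE.
  apply: smoothM => //; first exact: smooth_cst.
  apply: smooth_entry => //; apply: smooth_mulmx => //; exact: smooth_checkP.
- move=> a; apply: smooth_entry => //; apply: smooth_mulmx => //.
  apply: smooth_mulmx => //; first exact: smooth_dform.
  by have [] := sU.
- move=> a x Dx; apply/matrixP => s q; rewrite [LHS]mxE [LHS]mxE [RHS]mxE; congr (2 * _).
  have rE (A : 'M[R]_n.+1) i j : A i j = (delta_mx (0 : 'I_1) i *m A) 0 j by rewrite -rowE mxE.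
  by rewrite [LHS]rE [RHS]rE !mulmxA mul_checkPC.
move=> p x Dx; have [_ LU _] := sU.
rewrite -[RHS](lincomb_exists Dx); last first.
  have PP : L x *m (checkP L f p x *m checkP L f p x) = checkP L f p x *m checkP L f p x *m L x.
    by apply: mulmx_comm; exact: checkP_comm.
  by rewrite mulmxDr mulmxDl LU//; congr (_ + _).
apply: eq_bigr => a _; congr (_ *: _); rewrite quad_hamE /= E mulKf ?pnatr_eq0//.
have -> : checkP L f p x ^+ 2 = checkP L f p x *m checkP L f p x by [].
by rewrite mulmxDr mulmxA (checkP_dform p reg Dx) mulmxDl mxDij.
Qed.
End Smoothness.

Section Family.
Variables (g : 'I_n.+1 -> operator_field) (V : 'I_n.+1 -> point -> R).
Hypothesis ham : is_ham_family D L f M U g V.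

Lemma ham_polar x p q : D x ->
  \sum_a (p *m g a x *m q^T) 0 0 *: M a x = 2 *: (checkP L f p x *m checkP L f q x).
Proof.
move=> Dx; have [_ _ gT H] := ham; have Hq r := H r x Dx.
(* The value at momentum 0 restores the balance of the potentials: V on the left and U on the right
   cancel. *)
have E : \sum_a (p *m g a x *m q^T) 0 0 *: M a x =
    \sum_a quad_ham (g a) (V a) (p + q, x) *: M a x - \sum_a quad_ham (g a) (V a) (p, x) *: M a x
    - \sum_a quad_ham (g a) (V a) (q, x) *: M a x + \sum_a quad_ham (g a) (V a) (0, x) *: M a x.
  rewrite -!sumrB -big_split; apply: eq_bigr => a _ /=.
  rewrite -!scalerBl -scalerDl; congr (_ *: _).
  rewrite !quad_hamE /= linearD /= !mulmxDl !mulmxDr !mul0mx !mxDij [(0 : 'M[R]_1) 0 0]mxE.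
  have -> : (q *m g a x *m p^T) 0 0 = (p *m g a x *m q^T) 0 0.
    by rewrite -[LHS]mx00_tr !trmx_mul trmxK gT// mulmxA.
  move: ((p *m g a x *m p^T) 0 0) ((p *m g a x *m q^T) 0 0) ((q *m g a x *m q^T) 0 0) (V a x).
  by move=> a1 a2 a3 a4; field.
rewrite E !Hq checkPD checkP0 expr0n /= add0r.
have sq (A : 'M[R]_n.+1) : A ^+ 2 = A *m A by [].
rewrite !sq mulmxDl !mulmxDr (checkP_commute q p Dx) scaler_nat mulr2n.
move: (checkP L f p x *m checkP L f p x) (checkP L f q x *m checkP L f q x) => A B.
move: (checkP L f p x *m checkP L f q x) (U x) => C W; apply/matrixP => i j.
by rewrite !(mxDij, mxNij); ring.
Qed.

(** Replacing p by p L multiplies checkP(p) by L, and this factor can be passed to checkP(q);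
    comparing coefficients in the basis M_a gives the claim for each a. *)
Lemma ham_selfadj a x j k : D x -> \sum_p L x j p * g a x p k = \sum_p g a x j p * L x k p.
Proof.
move=> Dx.
have H p q : (p *m L x *m g a x *m q^T) 0 0 = (p *m g a x *m (q *m L x)^T) 0 0.
  move: a; apply: lincomb_inj (Dx) _; rewrite !ham_polar// !checkP_mulL//.
  by rewrite -mulmxA checkP_comm.
have := H (delta_mx 0 j) (delta_mx 0 k); rewrite trmx_mul trmx_delta.
rewrite !mulmxA mulmx_delta00 mulmx_delta00.
rewrite -!mulmxA -!rowE [LHS]mxE [RHS]mxE [LHS]mxE [RHS]mxE => ->.
by apply: eq_bigr => p _; rewrite [X in _ * X]mxE.
Qed.

End Family.

End HamiltonianFamily.

(** * Functional independence and non-degeneracy *)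

Lemma det_shift_neq0 (R : realFieldType) (n : nat) (A : 'M[R]_n) (e : R) : 0 < e ->
  exists2 t, 0 < t < e & \det (A + t%:M) != 0.
Proof.
move=> e0; set q := char_poly (- A).
have qE t : q.[t] = \det (A + t%:M).
  rewrite /q /char_poly -[LHS]/(horner_eval t _) -det_map_mx; congr (\det _).
  by apply/matrixP => i j; rewrite !mxE /= /horner_eval !hornerE hornerMn hornerX opprK addrC.
(* One more point than the degree of q, so that not all can be roots; the denominators start at 2 to
   keep the points strictly below e. *)
pose s := [seq e / k.+2%:R | k <- iota 0 (size q)].
have us : uniq s.
  rewrite map_inj_in_uniq ?iota_uniq// => i j _ _ /(mulfI (lt0r_neq0 e0)) /invr_inj /eqP.
  by rewrite eqr_nat => /eqP [].
have [all0|] := boolP (all (root q) s).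
  have q0 : q != 0 by rewrite -size_poly_gt0 size_char_poly.
  by have := max_poly_roots q0 all0 us; rewrite size_map size_iota ltnn.
move=> /allPn[_ /mapP[k _ ->]]; rewrite /root qE => dt; exists (e / k.+2%:R) => //.
by rewrite divr_gt0//= ltr_pdivrMr// ltr_pMr// ltr1n.
Qed.

(** Completes a vector of generic coefficients to a change of basis. In the rank factorisation of w
    the row factor is a 1 x 1 scalar, which is absorbed into the invertible column factor. *)
Lemma unit_with_col (R : fieldType) (n : nat) (w : 'cV[R]_n.+1) : w != 0 ->
  exists2 B : 'M[R]_n.+1, B \in unitmx & B *m delta_mx 0 0 = w.
Proof.
move=> w0; have rw : \rank w = 1%N.
  apply/eqP; rewrite eqn_leq rank_leq_col lt0n mxrank_eq0 w0. by [].
have := mulmx_ebase w; rewrite rw => wE.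
have ur := row_ebase_unit w; set r := row_ebase w in wE ur.
have rE : r = (r 0 0)%:M by apply/matrixP => i j; rewrite !ord1 mxE eqxx mulr1n.
have r0 : r 0 0 != 0 by move: ur; rewrite unitmxE det_mx11 unitfE.
exists (r 0 0 *: col_ebase w).
  by rewrite unitmxZ ?unitfE// col_ebase_unit.
rewrite -[RHS]wE [in RHS]rE mul_mx_scalar -scalemxAl; congr (_ *: (_ *m _)).
by apply/matrixP => i j; rewrite !mxE ord1 /=; case: i => -[|i] hi.
Qed.

Section AlgebraicSet.
(* The notations of mpoly clash with those of the analysis library. *)
Import (canonicals) mpoly.

(** The determinant is formed over the polynomial ring, and evaluation, a ring morphism, commutes
    with it. *)
Lemma det_comb_algebraic (R : realType) (m n : nat) (G : 'I_m -> 'M[R]_n) :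
  algebraic_set [set a : 'I_m -> R | \det (\sum_k a k *: G k) = 0].
Proof.
pose q : mpoly.mpoly m R := \det (\sum_k (\matrix_(i, j)
  (mpoly.mpolyX R (mpoly.mnm1 k) * mpoly.mpolyC m (G k i j)) : 'M[mpoly.mpoly m R]_n)).
have qE a : mpoly.meval a q = \det (\sum_k a k *: G k).
  rewrite -det_map_mx; congr (\det _); apply/matrixP => i j.
  rewrite mxE !summxE rmorph_sum; apply: eq_bigr => k _.
  by rewrite !mxE rmorphM /= mpoly.mevalXU mpoly.mevalC.
exists [set q]; apply/seteqP; split=> a /=.
  by move=> d _ ->; rewrite qE.
by move=> /(_ q erefl); rewrite qE.
Qed.

End AlgebraicSet.

Section Independence.
Context {R : realType} {n : nat} (D : set 'cV[R]_n.+1)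
  (L : 'cV[R]_n.+1 -> 'M[R]_n.+1) (f : 'cV[R]_n.+1 -> R).
Notation point := 'cV[R]_n.+1.
Notation operator_field := (point -> 'M[R]_n.+1).
Notation phase := ('rV[R]_n.+1 * 'cV[R]_n.+1)%type.
Implicit Types (x y : point) (p q : 'rV[R]_n.+1) (z : phase).
Variables (M : 'I_n.+1 -> operator_field) (U : operator_field).
Variables (g : 'I_n.+1 -> operator_field) (V : 'I_n.+1 -> point -> R).
Hypotheses (oD : open D) (sL : smooth_on D L) (cf : conservation_law D L f)
  (reg : regular_law D L f) (bM : sym_basis D L M) (ham : is_ham_family D L f M U g V).

Lemma open_cotangent : open (cotangent D).
Proof. by apply: open_comp => // z _; exact: cvg_snd. Qed.

Lemma smooth_on_snd (W : normedModType R) (F : point -> W) :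
  smooth_on D F -> smooth_on (cotangent D) ((fun z => F z.2) : phase -> W).
Proof.
apply: (@smooth_affine_comp _ _ _ _ F (snd : phase -> _) (snd : {linear phase -> _}) 0).
- exact: open_cotangent.
- by move=> z; exact: cvg_snd.
- by move=> z; rewrite addr0.
- by [].
Qed.

Lemma smooth_quad_ham a : smooth_on (cotangent D) (quad_ham (g a) (V a) : phase -> R^o).
Proof.
have oT := open_cotangent; have [sg sV _ _] := ham.
apply: smoothD => //; last exact: (@smooth_on_snd R^o (V a)).
apply: smoothM => //; first exact: smooth_cst.
apply: smooth_sum => // s; apply: smooth_sum => // q.
apply: smoothM => //; last by apply: smooth_entry => //; exact: smooth_fst.
apply: smoothM => //; last by apply: smooth_entry => //; exact: smooth_fst.
by apply: smooth_entry => //; exact: smooth_on_snd.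
Qed.

Lemma partial_fst_ham a i z : D z.2 ->
  partial_fst i (quad_ham (g a) (V a)) z = (z.1 *m g a z.2) 0 i.
Proof.
move=> Dz; rewrite /partial_fst; set e : phase := (delta_mx 0 i, 0).
have [_ _ gT _] := ham; set G := g a z.2; set c := (z.1 *m G) 0 i.
have hE (t : R) : quad_ham (g a) (V a) (t *: e + z) =
    quad_ham (g a) (V a) z + t * c + t ^+ 2 * (2^-1 * G i i).
  rewrite !quad_hamE -[(t *: e + z).1]/(t *: delta_mx 0 i + z.1).
  rewrite (_ : (t *: e + z).2 = z.2); last first.
    by rewrite -[LHS]/(t *: 0 + z.2) scaler0 add0r.
  rewrite linearD linearZ /= trmx_delta -/G !mulmxDl !mulmxDr.
  rewrite -!scalemxAl -!scalemxAr -?scalemxAl !mxDij !mxZij.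
  have -> : (delta_mx (0 : 'I_1) i *m G *m z.1^T) 0 0 = c.
    by rewrite -[LHS]mx00_tr !trmx_mul trmxK trmx_delta gT// mulmxA mulmx_delta00.
  have -> : (delta_mx (0 : 'I_1) i *m G *m delta_mx i (0 : 'I_1)) 0 0 = G i i.
    by rewrite mulmx_delta00 -rowE mxE.
  rewrite mulmx_delta00 -/c.
  by move: ((z.1 *m G *m z.1^T) 0 0) (V a z.2) (G i i) => b1 b2 b3; field.
rewrite /derive; apply: cvg_lim => //.
have ck : (fun t : R => c + t * (2^-1 * G i i)) @ 0^' --> c.
  rewrite -[X in _ --> X]addr0 -[X in _ --> _ + X](mul0r (2^-1 * G i i)).
  apply: cvgD; first exact: cvg_cst.
  by apply: cvgMl; exact: nbhs_dnbhs.
apply: cvg_trans ck; apply: near_eq_cvg; near=> t.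
have t0 : t != 0 by near: t; exact: nbhs_dnbhs_neq.
rewrite /= hE -[RHS]/(t^-1 * (_ - _)).
by move: (quad_ham _ _ _) (2^-1 * G i i) => b1 b2; field.
Unshelve. all: by end_near. Qed.

(** The open dense set is where checkP(p) is invertible; it is dense because checkP(p + s df) =
    checkP(p) + s Id. There the p-derivatives p g_a already suffice: with q such that checkP(q) =
    (1/2) checkP(p)^-1 M_b, polarization gives p g_a q^T = 1 for a = b and 0 otherwise, which
    isolates the coefficient k_b of a linear relation. *)
Lemma ham_independent : functionally_independent D (fun a => quad_ham (g a) (V a)).
Proof.
have oT := open_cotangent; have sth := smooth_dform oD cf.1.
pose P z := checkP L f z.1 z.2.
have sP : smooth_on (cotangent D) (P : phase -> _).
  apply: smooth_sum => // k; apply: smooth_scalemx => //; last first.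
    exact: smooth_on_snd (smooth_exp _ oD sL).
  apply: smooth_entry => //; apply: smooth_mulmx => //; first exact: smooth_fst.
  exact: smooth_on_snd (smooth_inv_coframe reg oD sL cf.1).
have sdP := smooth_det oT sP.
exists [set z | D z.2 /\ \det (P z) != 0]; split.
- rewrite openE => z [Dz dz]; rewrite /interior.
  have cd := differentiable_continuous (smooth_diff sdP Dz).
  have nd : \forall y \near z, \det (P y) != 0.
    by apply: (cd [set r : R | r != 0]); apply: open_nbhs_nbhs; split=> //; exact: open_neq.
  near=> y; split; first by near: y; exact: open_nbhs_nbhs.
  by near: y.
- by move=> z [].
- move=> [p x] Dx B /nbhs_ballP[e /= e0 eB].
  set t := dform f x; pose e' := e / (`|t| + 1).
  have e'0 : 0 < e' by rewrite divr_gt0// ltr_wpDl.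
  have [s /andP[s0 se] ds] := det_shift_neq0 (checkP L f p x) e'0.
  exists (s *: t + p, x); split; last first.
    apply: eB; rewrite -ball_normE /= prod_normE /= subrr normr0 gt_max e0 andbT.
    rewrite opprD addrCA subrr addr0 normrN normrZ gtr0_norm//.
    rewrite -[ltRHS](@divfK _ (`|t| + 1)) ?gt_eqF ?ltr_wpDl// -/e'.
    rewrite (le_lt_trans (ler_wpM2l (ltW s0) (_ : _ <= `|t| + 1))) ?lerDl//.
    by rewrite ltr_pM2r// ltr_wpDl.
  split=> //=; rewrite /P /= checkPD checkPZ (checkP_dformE reg Dx) addrC.
  by rewrite scalemx1.
move=> z [Dz dP].
have uP : P z \in unitmx by rewrite unitmxE unitfE.
apply/free_enumP => k k0 b.
have k0' i : \sum_a k a * (z.1 *m g a z.2) 0 i = 0.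
  have := congr1 (fun w : 'rV[R]_(n.+1 + n.+1) => w 0 (lshift _ i)) k0.
  rewrite /= summxE [RHS]mxE => H; rewrite -[RHS]H; apply: eq_bigr => a _.
  by rewrite mxZij /differential row_mxEl mxE partial_fst_ham.
have LP := checkP_comm L f z.1 z.2; rewrite -/(P z) in LP.
have LV : L z.2 *m invmx (P z) = invmx (P z) *m L z.2.
  by rewrite -[LHS](mulKmx uP) (mulmxA (P z)) -LP -(mulmxA (L z.2)) mulmxV// mulmx1.
have LB : L z.2 *m (2^-1 *: (invmx (P z) *m M b z.2)) = 2^-1 *: (invmx (P z) *m M b z.2) *m L z.2.
  by rewrite -scalemxAr -scalemxAl mulmx_comm// (sym_basis_comm bM).
pose q := dform f z.2 *m (2^-1 *: (invmx (P z) *m M b z.2)).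
have Pq : checkP L f q z.2 = 2^-1 *: (invmx (P z) *m M b z.2) := checkP_of_comm reg Dz LB.
have := ham_polar reg ham z.1 q Dz; rewrite Pq -/(P z) -scalemxAr.
rewrite scalerA mulfV ?pnatr_eq0// scale1r mulKVmx//.
have -> : M b z.2 = \sum_a (a == b)%:R *: M a z.2.
  by rewrite (bigD1 b)//= eqxx scale1r big1 ?addr0// => a /negPf ->; rewrite scale0r.
move=> /(lincomb_inj reg bM Dz) E.
transitivity (\sum_a k a * (z.1 *m g a z.2 *m q^T) 0 0).
  under eq_bigr do rewrite E.
  by rewrite (bigD1 b)//= eqxx mulr1 big1 ?addr0// => a /negPf ->; rewrite mulr0.
under eq_bigr do rewrite mxE mulr_sumr.
rewrite exchange_big big1// => i _; under eq_bigr do rewrite mulrA.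
by rewrite -mulr_suml k0' mul0r.
Unshelve. all: by end_near. Qed.

(* Frobenius form: with v the cyclic vector dual to df and a_k = df M_k v, the
   form sum_k a_k g_k is (p, q) |-> 2 df P(p) P(q) v. *)
Lemma ham_generic_nondegenerate x : D x ->
  exists a : 'I_n.+1 -> R, \det (\sum_k a k *: g k x) != 0.
Proof.
move=> Dx; have uC := regular_law_unit reg Dx.
pose v := cyc_col (dform f x) (L x).
exists (fun k => (dform f x *m M k x *m v) 0 0); set G := \sum_k _.
have GE p q : (q *m G *m p^T) 0 0 = 2 * (p *m checkP L f q x *m v) 0 0.
  have := congr1 (fun A => (dform f x *m A *m v) 0 0) (ham_polar reg ham p q Dx).
  move=> /=; rewrite -scalemxAr -scalemxAl mxZij (mulmxA (dform f x)).
  rewrite (checkP_dform p reg Dx) => <-.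
  rewrite /G mulmx_sumr !mulmx_suml !summxE mulmx_sumr mulmx_suml summxE.
  have [_ _ gT _] := ham.
  apply: eq_bigr => k _; rewrite -!(scalemxAl, scalemxAr) !mxZij mulrC; congr (_ * _).
  by rewrite -[LHS]mx00_tr !trmx_mul trmxK gT// mulmxA.
rewrite -unitfE -unitmxE -row_free_unit -kermx_eq0; apply/rowV0P => q /sub_kermxP qG.
have Pv : checkP L f q x *m v = 0.
  apply/colP => i; have := GE (delta_mx 0 i) q; rewrite qG mul0mx mxE => /esym/eqP.
  by rewrite mulf_eq0 pnatr_eq0 /= -mulmxA -rowE mxE => /eqP ->; rewrite mxE.
have P0 := cyc_col_inj uC (checkP_comm L f q x) Pv.
by rewrite -(checkP_dform q reg Dx) P0 mulmx0.
Qed.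

End Independence.

(** * Poisson commutativity *)

Section Poisson.
Context {R : realType} {n : nat} (D : set 'cV[R]_n.+1)
  (L : 'cV[R]_n.+1 -> 'M[R]_n.+1) (f : 'cV[R]_n.+1 -> R).
Notation point := 'cV[R]_n.+1.
Notation operator_field := (point -> 'M[R]_n.+1).
Notation phase := ('rV[R]_n.+1 * 'cV[R]_n.+1)%type.
Implicit Types (x y : point) (p q : 'rV[R]_n.+1) (z : phase).
Variables (M : 'I_n.+1 -> operator_field) (U : operator_field).
Variables (g : 'I_n.+1 -> operator_field) (V : 'I_n.+1 -> point -> R).
Hypotheses (oD : open D) (sL : smooth_on D L) (nL : nijenhuis D L)
  (cf : conservation_law D L f) (reg : regular_law D L f) (bM : sym_basis D L M)
  (sU : strong_symmetry D L U) (ham : is_ham_family D L f M U g V).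

Lemma derive_fst_dir (F : phase -> R) z (w : 'rV[R]_n.+1) : differentiable (F : phase -> R^o) z ->
  'D_((w, 0) : phase) (F : phase -> R^o) z = \sum_i w 0 i * partial_fst i F z.
Proof. by move=> dF; rewrite fst_dirE derive_dirsum. Qed.

Lemma derive_snd_dir (F : phase -> R) z (w : point) : differentiable (F : phase -> R^o) z ->
  'D_((0, w) : phase) (F : phase -> R^o) z = \sum_i w i 0 * partial_snd i F z.
Proof. by move=> dF; rewrite snd_dirE derive_dirsum. Qed.

Lemma derive_on_section (F : phase -> R) (al : point -> 'rV[R]_n.+1) x xi :
  differentiable al x -> differentiable (F : phase -> R^o) (al x, x) ->
  differentiable ((fun y => F (al y, y)) : point -> R^o) x /\
  'D_xi ((fun y => F (al y, y)) : point -> R^o) x =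
  'D_(('D_xi al x, 0) : phase) (F : phase -> R^o) (al x, x) +
  'D_((0, xi) : phase) (F : phase -> R^o) (al x, x).
Proof.
move=> dal dF.
have did : differentiable (id : point -> point) x by [].
have dp : differentiable (fun y => (al y, y) : phase) x by exact: differentiable_pair.
have dc := differentiable_comp dp dF.
split; first exact: dc.
rewrite (deriveE xi dc) (diff_comp dp dF) /= (diff_pair dal did) /=.
rewrite -(deriveE xi dal) -(deriveE xi did) derive_id -(deriveE _ dF).
have -> : (('D_xi al x, xi) : phase) = 1 *: ('D_xi al x, 0) + (0, xi).
  by rewrite -[RHS]/(1 *: 'D_xi al x + 0, 1 *: 0 + xi) !scale1r addr0 add0r.
by rewrite derive_linear// scale1r.
Qed.

Lemma closed_coframe (m : 'rV[R]_n.+1) x : D x ->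
  differentiable (fun y => m *m companion_coframe L f y) x /\
  closed_at (fun y => m *m companion_coframe L f y) x.
Proof.
move=> Dx; have sth := smooth_dform oD cf.1.
have dk k : differentiable (fun y => dform f y *m L y ^+ k) x.
  by apply: smooth_diff Dx; apply: smooth_mulmx => //; exact: smooth_exp.
have -> : (fun y => m *m companion_coframe L f y) =
    \sum_(k < n.+1) (m 0 k \*: (fun y => dform f y *m L y ^+ k)).
  apply/funext => y; rewrite fct_sumE mulmx_sum_row; apply: eq_bigr => k _.
  by rewrite -[companion_coframe L f y]/(cyc_mx (dform f y) (L y)) row_cyc_mx.
split; first by apply: differentiable_sum => k; exact: differentiableZ.
move=> xi eta.
have E (v : point) : 'D_v (\sum_(k < n.+1) (m 0 k \*: (fun y => dform f y *m L y ^+ k))) x =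
    \sum_(k < n.+1) m 0 k *: 'D_v (fun y => dform f y *m L y ^+ k) x.
  rewrite derive_sum; last by move=> k; apply: derivableZ; exact: diff_derivable.
  by apply: eq_bigr => k _; rewrite deriveZ//; exact: diff_derivable.
have S (v : 'I_n.+1 -> 'rV[R]_n.+1) (w : point) :
    ((\sum_k m 0 k *: v k) *m w) 0 0 = \sum_k m 0 k * (v k *m w) 0 0.
  by rewrite mulmx_suml summxE; apply: eq_bigr => k _; rewrite -scalemxAl mxZij.
rewrite (E xi) (E eta) (S (fun k => 'D_xi (fun y => dform f y *m L y ^+ k) x)).
rewrite (S (fun k => 'D_eta (fun y => dform f y *m L y ^+ k) x)).
apply: eq_bigr => k _; congr (_ * _).
exact: (closed_dformX oD sL nL cf reg k Dx).
Qed.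

(* k_a is h_a restricted to the Lagrangian section p = sum_k m_k df L^k of T^*M *)
Lemma section_symmetry (m : 'rV[R]_n.+1) x (k := fun a y => quad_ham (g a) (V a)
    (m *m companion_coframe L f y, y)) : D x ->
  (forall a, differentiable (k a : point -> R^o) x) ->
  forall xi, \sum_a 'D_(L x *m xi) (k a : point -> R^o) x *: M a x =
    L x *m \sum_a 'D_xi (k a : point -> R^o) x *: M a x.
Proof.
move=> Dx dk xi; have dL := smooth_diff sL Dx.
have [sM _] := bM; have dM a : differentiable (M a) x.
  by have [s _ _] := sM a; exact: smooth_diff s Dx.
pose Q y := \sum_(j < n.+1) m 0 j *: L y ^+ j.
have sQ : smooth_on D Q.
  apply: smooth_sum => // j; apply: smooth_scalemx => //; last exact: smooth_exp.
  exact: (@smooth_cst _ _ R^o).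
have dQ := smooth_diff sQ Dx.
have dfQ eta eta' : defect L Q x eta eta' = 0.
  have dX (j : 'I_n.+1) : differentiable (fun y => L y ^+ j) x.
    exact: smooth_diff (smooth_exp j oD sL) Dx.
  have dc (j : 'I_n.+1) : differentiable (cst (m 0 j) : point -> R^o) x.
    exact: differentiable_cst.
  rewrite [LHS](defect_sum _ _ _ dL dX dc) big1// => j _.
  rewrite derive_cst derive_cst !scale0r subrr addr0.
  by rewrite (defectX oD sL nL _ _ _ Dx) scaler0.
have QE y : D y -> Q y *m Q y + U y = \sum_a k a y *: M a y.
  move=> Dy; have [_ _ _ H] := ham; rewrite /k H//; congr (_ + _).
  rewrite /checkP /companion_momenta mulmxK//.
  exact: (regular_law_unit reg Dy).
have LQ : L x *m Q x = Q x *m L x by exact: comm_mx_poly.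
have dU : differentiable U x by have [s _ _] := sU; exact: smooth_diff s Dx.
have N0 eta : defect L (fun y => \sum_a k a y *: M a y) x xi eta = 0.
  have E : {near x, (fun y => Q y *m Q y + U y) =1 (fun y => \sum_a k a y *: M a y)}.
    by near=> y; apply: QE; near: y; exact: open_nbhs_nbhs.
  rewrite -(defect_ext _ _ _ E) defectD//; last exact: differentiable_mulmx.
  by rewrite defect_mulmx// !dfQ mulmx0 add0r add0r (strong_symmetry_defect sL sU Dx).
have N1 (eta : point) : \sum_a 'D_(L x *m xi) (k a : point -> R^o) x *: M a x *m eta =
    L x *m (\sum_a 'D_xi (k a : point -> R^o) x *: M a x) *m eta.
  have H := N0 eta; rewrite (defect_sum _ _ _ dL dM dk) in H.
  apply: subr0_eq; rewrite -[RHS]H mulmx_sumr mulmx_suml -sumrB; apply: eq_bigr => a _.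
  rewrite (strong_symmetry_defect sL (sM a) Dx) scaler0 add0r.
  move: ('D_(L x *m xi) (k a : point -> R^o) x) ('D_xi (k a : point -> R^o) x) => k1 k2.
  by rewrite -!scalemxAr -!scalemxAl mulmxA.
apply/matrixP => i j; rewrite -[LHS]mulmx_deltaij -[RHS]mulmx_deltaij -N1.
by rewrite mulmx_suml.
Unshelve. all: by end_near. Qed.

(** With X_c = dh_c/dp, the derivative of k_c along xi is ('D_xi al) X_c plus the u-derivative of
    h_c along xi. Closedness of al makes the first term symmetric for (k_b, X_a) and (k_a, X_b), so
    the bracket equals dk_b(X_a) - dk_a(X_b). *)
Lemma ham_poisson a b z : D z.2 ->
  poisson (quad_ham (g a) (V a)) (quad_ham (g b) (V b)) z = 0.
Proof.
case: z => p x /= Dx; have uC := regular_law_unit reg Dx.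
pose h c : phase -> R := quad_ham (g c) (V c).
have dh c : differentiable (h c : phase -> R^o) (p, x).
  by apply: (smooth_diff (smooth_quad_ham oD ham c)); exact: Dx.
pose X c : point := (p *m g c x)^T.
have XE c i : partial_fst i (h c) (p, x) = X c i 0.
  by rewrite [RHS]mxE; exact: (partial_fst_ham ham c i (z := (p, x)) Dx).
pose D2 c (xi : point) := 'D_((0, xi) : phase) (h c : phase -> R^o) (p, x).
have -> : poisson (quad_ham (g a) (V a)) (quad_ham (g b) (V b)) (p, x) = D2 b (X a) - D2 a (X b).
  rewrite /D2 !derive_snd_dir// -sumrB; apply: eq_bigr => i _.
  by rewrite -/(h a) -/(h b) !XE [partial_snd i (h a) _ * _]mulrC.
pose m := companion_momenta L f p x; pose al y := m *m companion_coframe L f y.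
have alx : al x = p by rewrite /al /m /companion_momenta mulmxKV.
have [dal cal] := closed_coframe m Dx.
pose k c : point -> R := fun y => h c (al y, y).
have dhal c : differentiable (h c : phase -> R^o) (al x, x) by rewrite alx.
have dk c : differentiable (k c : point -> R^o) x.
  by have [] := derive_on_section 0 dal (dhal c).
have kE c xi : 'D_xi (k c : point -> R^o) x = ('D_xi al x *m X c) 0 0 + D2 c xi.
  have [_] := derive_on_section xi dal (dhal c); rewrite -/(al x) alx => ->; congr (_ + _).
  by rewrite derive_fst_dir// [RHS]mxE; apply: eq_bigr => i _; rewrite XE.
suff sym : 'D_(X a) (k b : point -> R^o) x = 'D_(X b) (k a : point -> R^o) x.
  move: sym; rewrite !kE (cal (X a) (X b)) => /addrI ->; exact: subrr.
have YL := section_symmetry Dx dk.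
pose Y xi := \sum_c 'D_xi (k c : point -> R^o) x *: M c x.
have Ycomm xi : L x *m Y xi = Y xi *m L x.
  exact: (comm_lincomb bM (fun c => 'D_xi (k c : point -> R^o) x)).
have YX j xi : Y (L x ^+ j *m xi) = L x ^+ j *m Y xi.
  elim: j => [|j IH]; first by rewrite expr0 !mul1mx.
  by rewrite exprS -mulmxE -!mulmxA -IH; exact: YL.
have Ysum (e : 'I_n.+1 -> R) (v : 'I_n.+1 -> point) :
    Y (\sum_j e j *: v j) = \sum_j e j *: Y (v j).
  under [RHS]eq_bigr do rewrite /Y scaler_sumr.
  rewrite exchange_big; apply: eq_bigr => c _ /=.
  rewrite derive_dirsum// scaler_suml; apply: eq_bigr => j _.
  by rewrite scalerA.
have YB B xi : L x *m B = B *m L x -> Y (B *m xi) = B *m Y xi.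
  move=> /(cyc_opE uC) ->; rewrite /cyc_op !mulmx_suml.
  under eq_bigr do rewrite -scalemxAl; rewrite Ysum.
  by apply: eq_bigr => j _; rewrite YX scalemxAl.
(* The vectors dual to the basis M_a: df M_d w_c is 1 for d = c and 0 otherwise. Hence dk_c(xi) = df
   Y(xi) w_c, and polarization gives X_c = 2 checkP(p) w_c. *)
pose w c := col c (invmx (sym_frame f M x)).
have uF := sym_frame_unit reg bM Dx.
have wE c (e : 'I_n.+1 -> R) : (dform f x *m (\sum_d e d *: M d x) *m w c) 0 0 = e c.
  have -> : \sum_d e d *: M d x = \sum_d (\row_d e d) 0 d *: M d x.
    by apply: eq_bigr => d _; rewrite mxE.
  by rewrite dform_lincomb /w colE mulmxA mulmx_delta00 mulmxK// mxE.
have kY c xi : 'D_xi (k c : point -> R^o) x = (dform f x *m Y xi *m w c) 0 0.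
  by rewrite (wE c (fun d => 'D_xi (k d : point -> R^o) x)).
have Xw c : X c = 2 *: (checkP L f p x *m w c).
  have [_ _ gT _] := ham.
  apply/colP => i; have := wE c (fun d => (delta_mx (0 : 'I_1) i *m g d x *m p^T) 0 0).
  rewrite /= (ham_polar reg ham _ _ Dx) -scalemxAr -scalemxAl mulmxA (checkP_dform _ reg Dx).
  have -> : (2 *: (delta_mx (0 : 'I_1) i *m checkP L f p x *m w c)) 0 0 =
      (2 *: (checkP L f p x *m w c)) i 0.
    by rewrite mxZij [RHS]mxZij -mulmxA -rowE [X in _ * X]mxE.
  move=> ->; rewrite /X mxE -[RHS]mx00_tr !trmx_mul trmxK trmx_delta gT//.
  by rewrite mulmxA mulmx_delta00.
(* Writing w_a = W_a v and w_b = W_b v with the cyclic vector v gives dk_b(X_a) = 2 df P W_a Y(v)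
   W_b v. All operators here commute with L, hence with each other, so the value is unchanged when a
   and b are exchanged. *)
have [ba wa La] := cyc_col_surj uC (w a); have [bb wb Lb] := cyc_col_surj uC (w b).
set Wa := \sum_j _ *: _ in wa La; set Wb := \sum_j _ *: _ in wb Lb.
set v := cyc_col _ _ in wa wb; have LP := checkP_comm L f p x; set P := checkP L f p x in LP *.
have E W xi : L x *m W = W *m L x -> Y (2 *: (P *m (W *m xi))) = 2 *: (P *m W *m Y xi).
  move=> LW; have LB : L x *m (2 *: (P *m W)) = 2 *: (P *m W) *m L x.
    by rewrite -scalemxAr -scalemxAl mulmx_comm.
  by rewrite mulmxA scalemxAl YB// -scalemxAl.
rewrite !kY !Xw wa wb !E//.
have Lv := Ycomm v; congr ((_ : 'M[R]_1) 0 0).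
rewrite -!scalemxAr -!scalemxAl; congr (_ *: _).
rewrite -!mulmxA; congr (_ *m (_ *m _)).
rewrite !mulmxA; congr (_ *m _).
by rewrite (cyc_comm uC (mulmx_comm La Lv) Lb) (cyc_comm uC La Lv) mulmxA.
Qed.

End Poisson.

(** * Solutions of the Hamilton-Jacobi equation *)

Section HamiltonJacobi.
Context {R : realType} {n : nat}.
Notation point := 'cV[R]_n.+1.
Notation operator_field := (point -> 'M[R]_n.+1).
Notation phase := ('rV[R]_n.+1 * 'cV[R]_n.+1)%type.
Implicit Types (x : point) (c p q : 'rV[R]_n.+1) (z : phase).

Definition snd_inj (u : point) : phase := (0, u).
Lemma snd_inj_linear : linear snd_inj.
Proof. by move=> a u v; rewrite /snd_inj -[RHS]/(a *: 0 + 0, _) scaler0 addr0. Qed.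
HB.instance Definition _ := GRing.isLinear.Build _ _ _ _ snd_inj snd_inj_linear.

Lemma continuous_pair_cst c : continuous (fun u : point => (c, u) : phase).
Proof.
move=> u; apply: (@differentiable_continuous _ _ _ u (fun u : point => (c, u) : phase)).
exact: (differentiable_pair (differentiable_cst c u) (ex_diff (f := id))).
Qed.

Lemma continuous_snd_inj : continuous snd_inj.
Proof. exact: continuous_pair_cst. Qed.

Lemma slice_affine c u : ((c, u) : phase) = snd_inj u + (c, 0).
Proof. by rewrite /snd_inj -[RHS]/(0 + c, u + 0) addr0 add0r. Qed.

Lemma derive_slice (W : normedModType R) (F : phase -> W) c u w : differentiable F (c, u) ->
  'D_((0, w) : phase) F (c, u) = 'D_w (fun y => F (c, y)) u.
Proof.
move=> dF; exact: esym (derive_comp_affine w continuous_snd_inj (slice_affine c) dF).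
Qed.

Lemma smooth_sub (V W : normedModType R) (O O' : set V) (F : V -> W) :
  O' `<=` O -> smooth_on O F -> smooth_on O' F.
Proof. by move=> OO sF vs z /OO; exact: sF. Qed.

Lemma open_slice (Om : set phase) c : open Om -> open [set u | Om (c, u)].
Proof.
move=> oOm; have cs : continuous (fun u : point => (c, u) : phase).
  exact: continuous_pair_cst.
by apply: (open_comp _ oOm) => u _; exact: cs.
Qed.

Lemma smooth_slice (W : normedModType R) (Om : set phase) (F : phase -> W) c : open Om ->
  smooth_on Om F -> smooth_on [set u | Om (c, u)] (fun u => F (c, u)).
Proof.
move=> oOm; apply: (smooth_affine_comp (A0 := snd_inj) (c := (c, 0))).
- exact: open_slice.
- exact: continuous_snd_inj.
- exact: slice_affine.
- by [].
Qed.

Variables (D : set point) (L : operator_field) (f : point -> R).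
Variables (M : 'I_n.+1 -> operator_field) (U : operator_field).
Hypotheses (oD : open D) (sL : smooth_on D L) (nL : nijenhuis D L)
  (cf : conservation_law D L f) (reg : regular_law D L f) (bM : sym_basis D L M)
  (sU : strong_symmetry D L U).

Section Root.
Variables (Om : set phase) (rt : phase -> 'M[R]_n.+1).
Hypothesis root : smooth_good_root D M U Om rt.

Let oOm : open Om. Proof. by case: root. Qed.
Let OmD z : Om z -> D z.2. Proof. by case: root => _ + _ _; exact. Qed.
Let srt : smooth_on Om rt. Proof. by case: root. Qed.

Lemma root_sq z : Om z -> rt z *m rt z = \sum_a z.1 0 a *: M a z.2 - U z.2.
Proof. by move=> Oz; have [_ _ _ /(_ z Oz) [[<- _] _]] := root. Qed.

Lemma root_unit z : Om z -> rt z \in unitmx.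
Proof. by move=> Oz; have [_ _ _ /(_ z Oz) [_ d]] := root; rewrite unitmxE unitfE. Qed.

Lemma root_comm z : Om z -> L z.2 *m rt z = rt z *m L z.2.
Proof.
move=> Oz; have [_ _ _ /(_ z Oz) [[_ [p ->]] _]] := root.
have Dz := OmD Oz; have [_ LU _] := sU.
apply: comm_mx_horner; rewrite /comm_mx mulmxBr mulmxBl LU//.
by rewrite (comm_lincomb bM (fun a => z.1 0 a) Dz).
Qed.

Lemma root_defect z xi eta : Om z -> defect L (fun u => rt (z.1, u)) z.2 xi eta = 0.
Proof.
case: z => c x /= Oz; have Dx := OmD Oz; rewrite /= in Dx.
have oS := @open_slice Om c oOm; have sS := @smooth_slice _ Om rt c oOm srt.
apply: (defect_root sL nL reg oS _ Oz sS) => //.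
- by move=> u /OmD.
- by move=> u; exact: root_comm.
- exact: root_unit.
move=> {}xi {}eta; have dL := smooth_diff sL Dx.
have dM a : differentiable (M a) x by have [/(_ a)[s _ _] _] := bM; exact: smooth_diff s Dx.
have dU : differentiable U x by have [s _ _] := sU; exact: smooth_diff s Dx.
have dc (k : R) : differentiable (cst k : point -> R^o) x by exact: differentiable_cst.
have E : {near x, (fun u => rt (c, u) *m rt (c, u)) =1
    (fun u => \sum_a (cst (c 0 a) u) *: M a u + cst (-1) u *: U u)}.
  near=> u; rewrite (@root_sq (c, u)) /= ?scaleN1r//.
  by near: u; apply: open_nbhs_nbhs.
have dZU := (derive_scalemx 0 (dc (-1)) dU).1.
have dS : differentiable (fun u => \sum_a (cst (c 0 a) u) *: M a u) x.
  rewrite (_ : (fun u => _) = \sum_a (c 0 a \*: M a)); last first.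
    by apply/funext => u; rewrite fct_sumE.
  by apply: differentiable_sum => a; exact: differentiableZ.
rewrite (defect_ext _ _ _ E) defectD//.
rewrite (defect_sum _ _ _ dL dM (fun a => dc (c 0 a))) (defectZ _ _ dL dU (dc (-1))).
rewrite (strong_symmetry_defect sL sU Dx) !derive_cst !scale0r subrr addr0 scaler0 addr0.
rewrite big1// => a _; have [sM _] := bM.
by rewrite (strong_symmetry_defect sL (sM a) Dx) !derive_cst !scale0r subrr addr0 scaler0.
Unshelve. all: by end_near. Qed.

Lemma root_closed c : closed_form [set u | Om (c, u)] (fun u => dform f u *m rt (c, u)).
Proof.
move=> x Ox; have Dx := OmD Ox; rewrite /= in Dx.
have oS := @open_slice Om c oOm; have sS := @smooth_slice _ Om rt c oOm srt.
have sth := smooth_dform oD cf.1.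
apply/closed_at_entries.
  by apply: differentiable_mulmx; [exact: smooth_diff sth Dx|exact: smooth_diff sS Ox].
apply: (closed_dform_sym oD sL cf reg oS _ Ox sS).
- by move=> u /OmD.
- by move=> u; exact: root_comm.
- by move=> xi eta; exact: (root_defect xi eta Ox).
Qed.

Let al z := dform f z.2 *m rt z.

Let sal : smooth_on Om al.
Proof.
apply: smooth_mulmx => //; apply: (@smooth_sub _ _ (cotangent D)); first exact: OmD.
by apply: smooth_on_snd => //; exact: smooth_dform oD cf.1.
Qed.

Lemma root_primitive z : Om z -> exists (Om' : set phase) W,
  [/\ Om' z, Om' `<=` Om & generating_function f rt Om' W].
Proof.
move=> Oz.
have cl (y : phase) : Om y -> forall i j, partial_snd i (fun y => al y 0 j) y =
    partial_snd j (fun y => al y 0 i) y.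
  case: y => c x Oy i j.
  have de k : differentiable ((fun y => al y 0 k) : phase -> R^o) (c, x).
    by apply: differentiable_entry; exact: smooth_diff sal Oy.
  rewrite /partial_snd (derive_slice _ (de j)) (derive_slice _ (de i)).
  exact: root_closed.
have [Om' [W [zO' O'O oO' sW WE]]] := param_primitive oOm sal Oz cl.
by exists Om', W.
Qed.

Section Generating.
Variables (Om' : set phase) (W : phase -> R).
Hypotheses (OO : Om' `<=` Om) (gen : generating_function f rt Om' W).

(** At the momentum p = df R the operator checkP(p) is R itself, and R^2 + U = sum_a c_a M_a. So h_a
    = c_a for every a; the Hamilton-Jacobi equation is the component a = [ord0]. *)
Lemma hamilton_jacobi g V z : is_ham_family D L f M U g V -> Om' z ->
  2^-1 * (\sum_q \sum_s g ord0 z.2 q s * partial_snd q W z * partial_snd s W z)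
    + V ord0 z.2 = z.1 0 ord0.
Proof.
move=> ham Oz'; have Oz := OO Oz'; have Dz := OmD Oz.
have [_ _ /(_ z Oz') WE] := gen; have [_ _ _ /(_ (\row_i partial_snd i W z) z.2 Dz)] := ham.
rewrite WE (checkP_of_comm reg Dz (root_comm Oz)).
have -> : rt z ^+ 2 = rt z *m rt z by [].
rewrite root_sq// subrK => /(lincomb_inj reg bM Dz) /(_ ord0) <-.
rewrite /quad_ham /= -WE; congr (_ * _ + _).
by apply: eq_bigr => q _; apply: eq_bigr => s _; rewrite !mxE.
Qed.

(** The mixed derivatives are the components of df dR/dc_a, and 2 R dR/dc_a = M_a. The transposed
    matrix is therefore 1/2 times [sym_frame] times R^-1, a product of invertible factors. *)
Lemma mixed_hessian z : Om' z -> \det (\matrix_(i, a) partial_snd i (partial_fst a W) z) != 0.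
Proof.
move=> Oz'; have Oz := OO Oz'; have Dz := OmD Oz; have [oO' sW WE] := gen.
have drt := smooth_diff srt Oz.
pose e a : phase := (delta_mx 0 a, 0).
have snd0 (Z : normedModType R) (F : point -> Z) a : differentiable F z.2 ->
    differentiable ((fun y => F y.2) : phase -> Z) z /\
    'D_(e a) ((fun y => F y.2) : phase -> Z) z = 0.
  move=> dF; have csnd : continuous (snd : {linear phase -> point}) by move=> y; exact: cvg_snd.
  have dsnd : differentiable (snd : phase -> point) z.
    exact: (@linear_differentiable _ _ _ (snd : {linear phase -> point})).
  split; first exact: (differentiable_comp dsnd dF).
  have := derive_comp_affine (A := snd) (c := 0) (e a) csnd (fun y => esym (addr0 _)) dF.
  by rewrite /= derive0.
have nOm : \forall y \near z, Om' y by exact: open_nbhs_nbhs.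
have dL := (snd0 _ L 0 (smooth_diff sL Dz)).1.
(* L does not depend on c, so differentiating L R = R L in c_a shows that dR/dc_a commutes with L,
   and then with R. *)
have LR a : L z.2 *m 'D_(e a) rt z = 'D_(e a) rt z *m L z.2.
  have := derive_mulmx (e a) dL drt.
  rewrite (snd0 _ L a (smooth_diff sL Dz)).2 mul0mx add0r => <-.
  have := derive_mulmx (e a) drt dL.
  rewrite (snd0 _ L a (smooth_diff sL Dz)).2 mulmx0 addr0 => <-.
  by apply: near_eq_derive; near=> y; apply/root_comm/OO; near: y.
have RM a : 2 *: ('D_(e a) rt z *m rt z) = M a z.2.
  transitivity ('D_(e a) (fun y => rt y *m rt y) z).
    rewrite (derive_mulmx _ drt drt).
    rewrite (cyc_comm (regular_law_unit reg Dz) (root_comm Oz) (LR a)).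
    by rewrite scaler_nat mulr2n.
  rewrite (near_eq_derive (g := fun y : phase => \sum_b y.1 0 b *: M b y.2 - U y.2)); last first.
    by near=> y; apply/root_sq/OO; near: y.
  (* In the direction of c_a the expression is affine, and its difference quotient is constantly
     M_a. *)
  rewrite /derive; apply: cvg_lim => //.
  have ck : (fun=> M a z.2) @ (0 : R)^' --> M a z.2 by exact: cvg_cst.
  apply: cvg_trans ck; apply: near_eq_cvg; near=> t.
  have t0 : t != 0 by near: t; exact: nbhs_dnbhs_neq.
  rewrite -[RHS]/(t^-1 *: ((\sum_b (t *: delta_mx 0 a + z.1) 0 b *: M b (t *: 0 + z.2)
    - U (t *: 0 + z.2)) - (\sum_b z.1 0 b *: M b z.2 - U z.2))) scaler0 add0r.
  rewrite opprB addrA subrK -sumrB (bigD1 a)//= big1 ?addr0.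
    by rewrite -scalerBl !mxE !eqxx mulr1 addrK scalerA mulVf// scale1r.
  by move=> b ba; rewrite -scalerBl !mxE (negPf ba) andbF mulr0 add0r subrr scale0r.
have WR i a : partial_snd i (partial_fst a W) z = (dform f z.2 *m 'D_(e a) rt z) 0 i.
  rewrite /partial_snd /partial_fst derive_sym; last 3 first.
  - by near=> y; apply: smooth_diff sW _; near: y.
  - exact: smooth_diff (smooth_derive _ sW) Oz'.
  - exact: smooth_diff (smooth_derive _ sW) Oz'.
  rewrite (near_eq_derive (g := fun y => al y 0 i)); last first.
    near=> y; have O'y : Om' y by near: y.
    by rewrite /al -(WE y O'y) mxE.
  have sth := smooth_dform oD cf.1.
  have [dth th0] := snd0 _ (dform f) a (smooth_diff sth Dz).
  have dal : differentiable al z by exact: smooth_diff sal Oz.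
  by rewrite -(derive_entry _ 0 i dal) (derive_mulmx _ dth drt) th0 mul0mx add0r.
rewrite -det_tr (_ : _^T = 2^-1 *: (sym_frame f M z.2 *m invmx (rt z))).
  by rewrite -unitfE -unitmxE unitmxZ ?unitfE ?invr_eq0 ?pnatr_eq0// unitmx_mul unitmx_inv
    (root_unit Oz) (sym_frame_unit reg bM Dz).
apply/matrixP => a i; rewrite [LHS]mxE [LHS]mxE WR [RHS]mxE.
have -> : (sym_frame f M z.2 *m invmx (rt z)) a i =
    (row a (sym_frame f M z.2) *m invmx (rt z)) 0 i by rewrite -row_mul [RHS]mxE.
rewrite row_sym_frame -RM -scalemxAr -scalemxAl mxZij mulrA mulVf ?pnatr_eq0// mul1r.
by rewrite -!mulmxA mulmxV ?mulmx1// root_unit.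
Unshelve. all: by end_near. Qed.

End Generating.
End Root.
End HamiltonJacobi.

(** * Change of the basis of symmetries *)

Section ChangeOfBasis.
Context {R : realType} {n : nat} (D : set 'cV[R]_n.+1)
  (L : 'cV[R]_n.+1 -> 'M[R]_n.+1) (f : 'cV[R]_n.+1 -> R).
Notation point := 'cV[R]_n.+1.
Notation operator_field := (point -> 'M[R]_n.+1).
Variables (M : 'I_n.+1 -> operator_field) (U : operator_field).
Hypotheses (oD : open D) (sL : smooth_on D L) (reg : regular_law D L f) (bM : sym_basis D L M).

Lemma lie_bracket_lincomb (c : 'I_n.+1 -> R) (xi : point -> point)
    (zeta : 'I_n.+1 -> point -> point) x :
  differentiable xi x -> (forall b, differentiable (zeta b) x) ->
  lie_bracket xi (fun y => \sum_b c b *: zeta b y) x = \sum_b c b *: lie_bracket xi (zeta b) x.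
Proof.
move=> dxi dz; rewrite /lie_bracket.
have -> : (fun y => \sum_b c b *: zeta b y) = \sum_b (c b \*: zeta b).
  by apply/funext => y; rewrite fct_sumE.
rewrite derive_sum; last by move=> b; apply: derivableZ; exact: diff_derivable.
rewrite derive_dirsum// -sumrB; apply: eq_bigr => b _.
by rewrite deriveZ ?scalerBr//; exact: diff_derivable.
Qed.

Lemma strong_symmetry_lincomb (c : 'I_n.+1 -> R) :
  strong_symmetry D L (fun x => \sum_b c b *: M b x).
Proof.
have [sM _] := bM; split.
- apply: smooth_sum => // b; apply: smooth_scalemx => //; first exact: (@smooth_cst _ _ R^o).
  by have [] := sM b.
- by move=> x Dx; rewrite (comm_lincomb bM c Dx).
move=> xi eta sxi seta x Dx.
have dL := smooth_diff sL Dx; have dxi := smooth_diff sxi Dx; have deta := smooth_diff seta Dx.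
have dLxi : differentiable (op_app L xi) x by exact: differentiable_mulmx.
have dMeta b : differentiable (op_app (M b) eta) x.
  by apply: differentiable_mulmx => //; have [s _ _] := sM b; exact: smooth_diff s Dx.
have E : op_app (fun y => \sum_b c b *: M b y) eta = fun y => \sum_b c b *: op_app (M b) eta y.
  apply/funext => y; rewrite /op_app mulmx_suml; apply: eq_bigr => b _.
  by rewrite scalemxAl.
rewrite E !lie_bracket_lincomb// !mulmx_sumr !mulmx_suml -big_split -!sumrB big1// => b _ /=.
have [_ _ /(_ xi eta sxi seta x Dx)] := sM b.
move: (lie_bracket xi eta x) (lie_bracket (op_app L xi) (op_app (M b) eta) x)
  (lie_bracket xi (op_app (M b) eta) x) (lie_bracket (op_app L xi) eta x) => l1 l2 l3 l4 H.
by rewrite -!scalemxAr -!scalemxAl -scalerDr -!scalerBr H scaler0.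
Qed.

Variable A : 'M[R]_n.+1.
Hypothesis uA : A \in unitmx.
Let M' a x := \sum_b A a b *: M b x.

Lemma sym_basis_change : sym_basis D L M'.
Proof.
split=> [a|x Dx]; first exact: strong_symmetry_lincomb.
apply/free_enumP => k k0 a.
have : \sum_b ((\row_a k a) *m A) 0 b *: M b x = \sum_b 0 *: M b x.
  rewrite [RHS]big1 => [|b _]; last by rewrite scale0r.
  rewrite -[RHS]k0; under [RHS]eq_bigr do rewrite scaler_sumr.
  rewrite exchange_big; apply: eq_bigr => b _ /=; rewrite mxE scaler_suml.
  by apply: eq_bigr => d _; rewrite mxE scalerA.
move=> /(lincomb_inj reg bM Dx) kA.
have : (\row_a k a) *m A = 0 by apply/rowP => b; rewrite kA mxE.
by move=> /(congr1 (fun B => B *m invmx A)); rewrite mulmxK// mul0mx => /rowP/(_ a); rewrite !mxE.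
Qed.

(** The coefficients change contragrediently to the basis: h'_a = sum_b (A^-1)_ba h_b leaves sum_a
    h_a M_a unchanged. *)
Lemma ham_family_change g V : is_ham_family D L f M U g V ->
  is_ham_family D L f M' U (fun a x => \sum_b invmx A b a *: g b x)
    (fun a x => \sum_b invmx A b a * V b x).
Proof.
move=> [sg sV gT H]; split.
- move=> a; apply: smooth_sum => // b; apply: smooth_scalemx => //.
  exact: (@smooth_cst _ _ R^o).
- by move=> a; apply: smooth_sum => // b; apply: smoothM => //; exact: smooth_cst.
- move=> a x Dx; rewrite linear_sum; apply: eq_bigr => b _.
  by rewrite linearZ /= gT.
move=> p x Dx; rewrite -H//.
have hE a : quad_ham (fun x => \sum_b invmx A b a *: g b x) (fun x => \sum_b invmx A b a * V b x)
    (p, x) = \sum_b invmx A b a * quad_ham (g b) (V b) (p, x).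
  rewrite quad_hamE /= mulmx_sumr mulmx_suml summxE mulr_sumr -big_split.
  apply: eq_bigr => b _ /=; rewrite quad_hamE /= -scalemxAr -scalemxAl mxZij.
  by rewrite mulrDr mulrCA.
under eq_bigr do rewrite hE /M' scaler_sumr.
rewrite exchange_big; apply: eq_bigr => c _ /=.
under eq_bigr do rewrite scalerA.
rewrite -scaler_suml; congr (_ *: _).
under eq_bigr do rewrite mulr_suml.
rewrite exchange_big (bigD1 c)//= [X in _ + X]big1 ?addr0 => [|b bc].
  have := congr1 (fun B : 'M[R]_n.+1 => B c c) (mulVmx uA); rewrite !mxE eqxx => E.
  under eq_bigr do rewrite mulrAC.
  by rewrite -mulr_suml E mul1r.
have := congr1 (fun B : 'M[R]_n.+1 => B b c) (mulVmx uA); rewrite !mxE (negPf bc) => E.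
under eq_bigr do rewrite mulrAC.
by rewrite -mulr_suml E mul0r.
Qed.

End ChangeOfBasis.

Theorem theorem5p1 (R : realType) (n : nat) (D : set 'cV[R]_n.+1)
    (L : 'cV[R]_n.+1 -> 'M[R]_n.+1) (f : 'cV[R]_n.+1 -> R)
    (M : 'I_n.+1 -> 'cV[R]_n.+1 -> 'M[R]_n.+1) (U : 'cV[R]_n.+1 -> 'M[R]_n.+1) :
  open D -> smooth_on D L -> nijenhuis D L -> gl_regular D L ->
  conservation_law D L f -> regular_law D L f ->
  sym_basis D L M -> strong_symmetry D L U ->
  (* the equation does define functions h_a of the stated form *)
  (exists g V, is_ham_family D L f M U g V) /\
  forall (g : 'I_n.+1 -> 'cV[R]_n.+1 -> 'M[R]_n.+1)
    (V : 'I_n.+1 -> 'cV[R]_n.+1 -> R), is_ham_family D L f M U g V ->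
  [/\ (* 1 *)
      [/\ functionally_independent D (fun a => quad_ham (g a) (V a)),
          forall x, D x -> exists2 S : set ('I_n.+1 -> R),
            proper_algebraic_set S
            & forall a, ~ S a -> \det (\sum_k a k *: g k x) != 0
        & forall x0, D x0 -> exists2 A : 'M[R]_n.+1, A \in unitmx &
            let M' := fun a x => \sum_b A a b *: M b x in
            sym_basis D L M' /\
            exists g' V',
              [/\ is_ham_family D L f M' U g' V',
                  \forall x \near x0, \det (g' ord0 x) != 0
                & integrable_system D (fun a => quad_ham (g' a) (V' a))]],
      (* 2 *)
      forall a x, D x -> forall j k,
        \sum_p L x j p * g a x p k = \sum_p g a x j p * L x k p
    & (* 3 *)
      forall (Om : set ('rV[R]_n.+1 * 'cV[R]_n.+1))
        (rt : 'rV[R]_n.+1 * 'cV[R]_n.+1 -> 'M[R]_n.+1),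
      smooth_good_root D M U Om rt ->
      [/\ forall c, closed_form [set u | Om (c, u)]
                      (fun u => dform f u *m rt (c, u)),
          forall z, Om z -> exists (Om' : set ('rV[R]_n.+1 * 'cV[R]_n.+1)) W,
            [/\ Om' z, Om' `<=` Om & generating_function f rt Om' W]
        & forall (Om' : set ('rV[R]_n.+1 * 'cV[R]_n.+1)) W,
            Om' `<=` Om -> generating_function f rt Om' W ->
            forall z, Om' z ->
              2^-1 * (\sum_q \sum_s
                 g ord0 z.2 q s * partial_snd q W z * partial_snd s W z)
                + V ord0 z.2 = z.1 0 ord0
              /\ \det (\matrix_(i, a) partial_snd i (partial_fst a W) z) != 0]].
Proof.
move=> oD sL nL _ cf reg bM sU.
split; first exact: (ham_family_exists reg bM sU oD sL cf.1).
move=> g V ham; split; first split.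
- exact: (ham_independent oD sL cf reg bM ham).
- move=> x Dx; exists [set a | \det (\sum_k a k *: g k x) = 0]; last by move=> a /eqP.
  split; first exact: det_comb_algebraic.
  have [a da] := ham_generic_nondegenerate reg ham Dx.
  by apply/eqP => E; have : setT a by []; rewrite -E /= => /eqP; rewrite (negPf da).
- move=> x0 Dx0; have [a da] := ham_generic_nondegenerate reg ham Dx0.
  have w0 : \col_b a b != 0.
    apply: contra_neq da => /colP w0; rewrite big1 ?det0// => k _.
    by have := w0 k; rewrite !mxE => ->; rewrite scale0r.
  (* With transition matrix B^-1 the new forms have coefficients from the columns of B. The first
     column is a, so g'_1 = sum_k a_k g_k is non-degenerate at x0, and near x0 by continuity of the
     determinant. *)
  have [B uB Bw] := unit_with_col w0.
  have uA : invmx B \in unitmx by rewrite unitmx_inv.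
  have bM' := sym_basis_change oD sL reg bM uA.
  have ham' := ham_family_change oD uA ham.
  exists (invmx B); first exact: uA.
  split; first exact: bM'.
  exists (fun a x => \sum_b invmx (invmx B) b a *: g b x).
  exists (fun a x => \sum_b invmx (invmx B) b a * V b x); split; first exact: ham'.
  + have [sg' _ _ _] := ham'; have sd := smooth_det oD (sg' ord0).
    have cd := differentiable_continuous (smooth_diff sd Dx0).
    apply: (cd [set r : R | r != 0]); apply: open_nbhs_nbhs; split; first exact: open_neq.
    rewrite /= invmxK (eq_bigr (fun k => a k *: g k x0))// => k _; congr (_ *: _).
    by have /colP/(_ k) := Bw; rewrite -colE !mxE.
  + split; first exact: (ham_independent oD sL cf reg bM' ham').
    by move=> b c z Dz; exact: (ham_poisson oD sL nL cf reg bM' sU ham' b c Dz).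
- by move=> a x Dx j k; exact: (ham_selfadj reg bM ham a j k Dx).
move=> Om rt root; split.
- exact: (root_closed oD sL nL cf reg bM sU root).
- by move=> z; exact: (root_primitive oD sL nL cf reg bM sU root).
move=> Om' W OO gen z Oz; split.
- exact: (hamilton_jacobi reg bM sU root OO gen ham Oz).
- exact: (mixed_hessian oD sL cf reg bM sU root OO gen Oz).
Qed.
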